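(* Let $\mathcal{A}$ be a finite list in a finitely generated abelian group $\Gamma$ and let $G$ be a torsion-wise finite divisible abelian group. Then all coefficients of the $G$-Tutte polynomial $T^G_{\mathcal{A}}(x,y)$ are non-negative integers.
   Context: $G$ is torsion-wise finite if $G[d]=\{x\in G\mid dx=0\}$ is finite for all $d>0$, and divisible if multiplication by $k$ is surjective on $G$ for every positive integer $k$. For a sublist $\mathcal{S}$ (distinguished by index) $r_{\mathcal{S}}$ is the rank of $\langle\mathcal{S}\rangle$, $m(\mathcal{S};G)=\#\mathrm{Hom}((\Gamma/\langle\mathcal{S}\rangle)_{\mathrm{tor}},G)$, and $T^G_{\mathcal{A}}(x,y)=\sum_{\mathcal{S}\subset\mathcal{A}}m(\mathcal{S};G)(x-1)^{r_{\mathcal{A}}-r_{\mathcal{S}}}(y-1)^{\#\mathcal{S}-r_{\mathcal{S}}}$. *)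

(* Defs.v *)
From HB Require Import structures.
From mathcomp Require Import all_boot all_order all_algebra.
From Stdlib Require Import ClassicalEpsilon.
Set Implicit Arguments. Unset Strict Implicit. Unset Printing Implicit Defensive.
Import GRing.Theory.
Local Open Scope ring_scope.

Section TutteDefs.
Variable Gam : zmodType.

(* integer linear combination  sum_i c_i s_i  (missing coefficients are 0) *)
Definition zcomb (s : seq Gam) (c : seq int) : Gam :=
  \sum_(i < size s) s`_i *~ c`_i.

Definition in_span (s : seq Gam) (x : Gam) : Prop :=
  exists c : seq int, x = zcomb s c.

Definition zindep (v : seq Gam) : Prop :=
  forall c : seq int, zcomb v c = 0 -> forall i, (i < size v)%N -> c`_i = 0.

Definition is_rank (s : seq Gam) (r : nat) : Prop :=
  (exists v : seq Gam, [/\ size v = r, zindep v &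
      forall i, (i < size v)%N -> in_span s v`_i]) /\
  (forall v : seq Gam, zindep v ->
      (forall i, (i < size v)%N -> in_span s v`_i) -> (size v <= r)%N).

Definition zrank (s : seq Gam) : nat := epsilon (inhabits 0%N) (is_rank s).

(* x + <s> lies in (Gam / <s>)_tor *)
Definition in_sat (s : seq Gam) (x : Gam) : Prop :=
  exists k : nat, (0 < k)%N /\ in_span s (x *+ k).

Variable G : zmodType.

(* homomorphisms (Gam/<s>)_tor -> G, represented by maps on the
   preimage {x | x + <s> torsion} that are additive and vanish on <s>;
   two such maps are identified when they agree on that preimage. *)
Definition is_torhom (s : seq Gam) (f : Gam -> G) : Prop :=
  (forall x y, in_sat s x -> in_sat s y -> f (x + y) = f x + f y) /\
  (forall x, in_span s x -> f x = 0).

Definition hom_count_is (s : seq Gam) (n : nat) : Prop :=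
  exists F : 'I_n -> (Gam -> G),
    [/\ forall i, is_torhom s (F i),
        forall i j, (forall x, in_sat s x -> F i x = F j x) -> i = j &
        forall f, is_torhom s f ->
          exists i, forall x, in_sat s x -> f x = F i x].

Definition mcount (s : seq Gam) : nat :=
  epsilon (inhabits 0%N) (hom_count_is s).

Definition sublist (A : seq Gam) (S : {set 'I_(size A)}) : seq Gam :=
  [seq A`_(val i) | i <- enum S].

(* G-Tutte polynomial as an element of Z[x][y]: outer variable y,
   inner variable x.  Coefficient of x^i y^j is ((tutteG A)`_j)`_i. *)
Definition tutteG (A : seq Gam) : {poly {poly int}} :=
  \sum_(S : {set 'I_(size A)})
     ((mcount (@sublist A S))%:Z)%:P%:P
     * (('X - 1) ^+ (zrank A - zrank (@sublist A S)))%:P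
     * ('X - 1) ^+ (#|S| - zrank (@sublist A S)).

End TutteDefs.

Definition fingen (Gam : zmodType) : Prop :=
  exists gens : seq Gam, forall x : Gam, in_span gens x.

Definition torsionwise_finite (G : zmodType) : Prop :=
  forall d : nat, (0 < d)%N ->
    exists s : seq G, forall x : G, x *+ d = 0 -> x \in s.

Definition divisible (G : zmodType) : Prop :=
  forall k : nat, (0 < k)%N -> forall y : G, exists x : G, x *+ k = y.

(* Main.v *)
Require Import Defs.
From HB Require Import structures.
From mathcomp Require Import all_boot all_order all_algebra.
From mathcomp Require Import boolp.
From mathcomp Require Import zify ring.
Set Implicit Arguments. Unset Strict Implicit. Unset Printing Implicit Defensive.
Import Order.TTheory GRing.Theory Num.Theory.
Local Open Scope ring_scope.

(** For R independent and E spanning, consider the part of the Tutte sum ranging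
over R <= S <= E. An element of E - R that is neither a loop modulo R nor a coloop
of E splits this sum into two sums of the same kind (deletion and contraction).
What remains are molecules, where E - R consists of coloops F and loops T and the
sum is that of m(R+F'+T') (x-1)^|F-F'| (y-1)^|T'| over F' <= F and T' <= T; its
coefficients are alternating sums of m over smaller molecules.

Since G is divisible, torsion homs extend, so the multiplicity is modular,
m(R+F'+T') m(R) = m(R+F') m(R+T'), and the alternating sum times m(R) is the
product of a sum over T' and a sum over F'. By inclusion-exclusion the first one
counts the homs that kill no element of T. The second one is of the same kind for
the transposed presentation matrix, where coloops become torsion basis vectors;
by the Smith normal form a matrix and its transpose have equally many torsion homs. *)

(** * Subgroups and rank *)

Section Subgroups.
Variable V : zmodType.
Implicit Types (H : V -> Prop) (s : seq V).

Definition subgroup H := H 0 /\ forall x y, H x -> H y -> H (x - y).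

Lemma subgroupN H x : subgroup H -> H x -> H (- x).
Proof. by move=> [H0 HB] Hx; rewrite -sub0r; apply: HB. Qed.

Lemma subgroupD H x y : subgroup H -> H x -> H y -> H (x + y).
Proof.
by move=> sH Hx Hy; rewrite -[y]opprK; apply: sH.2 => //; apply: subgroupN.
Qed.

Lemma subgroupMn H x n : subgroup H -> H x -> H (x *+ n).
Proof.
move=> sH Hx; elim: n => [|n IH]; first by rewrite mulr0n; case: sH.
by rewrite mulrS; apply: subgroupD.
Qed.

Lemma subgroupMz H x c : subgroup H -> H x -> H (x *~ c).
Proof.
move=> sH Hx; case: c => n; first exact: subgroupMn.
by rewrite NegzE mulrNz; apply: subgroupN => //; apply: subgroupMn.
Qed.

Lemma subgroup_sum H (I : Type) (r : seq I) (P : pred I) (F : I -> V) :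
  subgroup H -> (forall i, P i -> H (F i)) -> H (\sum_(i <- r | P i) F i).
Proof.
move=> sH HF; apply: (big_ind H) => //; first by case: sH.
by move=> x y; apply: subgroupD.
Qed.

Lemma zcomb_cons a s c : zcomb (a :: s) c = a *~ c`_0 + zcomb s (behead c).
Proof.
rewrite /zcomb /= big_ord_recl /=; congr (_ + _).
by apply: eq_bigr => i _; rewrite /bump /= nth_behead.
Qed.

Lemma in_span_nil (x : V) : in_span [::] x <-> x = 0.
Proof.
split; first by case=> c ->; rewrite /zcomb big_ord0.
by move=> ->; exists [::]; rewrite /zcomb big_ord0.
Qed.

Lemma in_span_cons a s x :
  in_span (a :: s) x <-> exists c y, in_span s y /\ x = a *~ c + y.
Proof.
split=> [[c ->]|[c [y [[d ->] ->]]]].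
  by rewrite zcomb_cons; exists c`_0, (zcomb s (behead c)); split=> //; exists (behead c).
by exists (c :: d); rewrite zcomb_cons.
Qed.

Lemma subgroup_span s : subgroup (in_span s).
Proof.
elim: s => [|a s IH].
  by split=> [|x y /in_span_nil-> /in_span_nil->]; apply/in_span_nil; rewrite ?subr0.
split.
  by apply/in_span_cons; exists 0, 0; split; [case: IH | rewrite mulr0z addr0].
move=> x y /in_span_cons[c [x' [Hx ->]]] /in_span_cons[d [y' [Hy ->]]].
apply/in_span_cons; exists (c - d), (x' - y'); split; first exact: IH.2.
by rewrite mulrzBr opprD addrACA.
Qed.

Lemma mem_in_span s x : x \in s -> in_span s x.
Proof.
elim: s => // a s IH; rewrite inE => /orP[/eqP->|/IH Hx]; apply/in_span_cons.
  by exists 1, 0; split; [case: (subgroup_span s) | rewrite mulr1z addr0].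
by exists 0, x; rewrite mulr0z add0r.
Qed.

Lemma span_min s H : subgroup H -> (forall x, x \in s -> H x) ->
  forall x, in_span s x -> H x.
Proof.
move=> sH Hs x [c ->]; apply: subgroup_sum => // i _.
by apply: subgroupMz => //; apply/Hs/mem_nth.
Qed.

(** The preimage in [V] of the torsion of [V/H]. Subgroups are predicates, so that sums and
    preimages need no generating list. *)
Definition sat H x := exists k : nat, (0 < k)%N /\ H (x *+ k).

Lemma sub_sat H x : H x -> sat H x.
Proof. by exists 1. Qed.

Lemma sat_mono H H' x : (forall y, H y -> H' y) -> sat H x -> sat H' x.
Proof. by move=> HH' [k [k0 Hk]]; exists k; split=> //; apply: HH'. Qed.

Lemma subgroup_sat H : subgroup H -> subgroup (sat H).
Proof.
move=> sH; split; first by apply: sub_sat; case: sH.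
move=> x y [k [k0 Hk]] [l [l0 Hl]]; exists (k * l)%N; rewrite muln_gt0 k0 l0.
split=> //; rewrite mulrnBl mulrnA; apply: sH.2; first exact: subgroupMn.
by rewrite mulnC mulrnA; apply: subgroupMn.
Qed.

Lemma sat_sat H x : sat (sat H) x -> sat H x.
Proof.
move=> [k [k0 [l [l0 Hl]]]]; exists (k * l)%N; rewrite muln_gt0 k0 l0.
by split=> //; rewrite mulrnA.
Qed.

Lemma satMz H x (c : int) : subgroup H -> c != 0 -> H (x *~ c) -> sat H x.
Proof.
move=> sH c0 Hc; exists `|c|%N; rewrite absz_gt0; split=> //.
case: c c0 Hc => // n _; rewrite NegzE mulrNz /= => /(subgroupN sH).
by rewrite opprK.
Qed.

Definition addg (H K : V -> Prop) x := exists y z, [/\ H y, K z & x = y + z].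

Lemma subgroup_addg H K : subgroup H -> subgroup K -> subgroup (addg H K).
Proof.
move=> sH sK; split; first by exists 0, 0; split; [case: sH|case: sK|rewrite addr0].
move=> _ _ [y [z [Hy Kz ->]]] [y' [z' [Hy' Kz' ->]]].
exists (y - y'), (z - z'); split; [exact: sH.2|exact: sK.2|].
by rewrite opprD addrACA.
Qed.

Lemma addgl H K x : subgroup K -> H x -> addg H K x.
Proof. by move=> [K0 _] Hx; exists x, 0; rewrite addr0. Qed.

Lemma addgr H K x : subgroup H -> K x -> addg H K x.
Proof. by move=> [H0 _] Hx; exists 0, x; rewrite add0r. Qed.

Lemma addg_min H K L x : subgroup L -> (forall y, H y -> L y) ->
  (forall y, K y -> L y) -> addg H K x -> L x.
Proof.
by move=> sL HL KL [y [z [/HL Hy /KL Kz ->]]]; apply: subgroupD.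
Qed.

Definition indep n (w : 'I_n -> V) :=
  forall c : 'I_n -> int, \sum_i w i *~ c i = 0 -> forall i, c i = 0.

Definition rank_is H r :=
  (exists w : 'I_r -> V, indep w /\ forall i, H (w i)) /\
  (forall n (w : 'I_n -> V), indep w -> (forall i, H (w i)) -> (n <= r)%N).

Lemma zindep_indep v : zindep v <-> indep (fun i : 'I_(size v) => v`_i).
Proof.
split=> [Hv c Hc i|Hv c Hc i Hi].
  pose d := [seq c j | j <- enum 'I_(size v)].
  have dE (j : 'I_(size v)) : d`_j = c j.
    by rewrite (nth_map j) ?size_enum_ord // nth_ord_enum.
  rewrite -dE; apply: Hv => //; apply: etrans Hc; rewrite /zcomb.
  by apply: eq_bigr => j _; rewrite dE.
exact: (Hv (fun j => c`_j) Hc (Ordinal Hi)).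
Qed.

Lemma is_rankE s r : is_rank s r <-> rank_is (in_span s) r.
Proof.
split=> [[[v [sv iv Hv]] Hmax]|[[w [iw Hw]] Hmax]].
  split.
    subst r; exists (fun i => v`_i); split; first exact/zindep_indep.
    by move=> i; apply: Hv.
  move=> n w iw Hw; pose v' := [seq w i | i <- enum 'I_n].
  have sv' : size v' = n by rewrite size_map size_enum_ord.
  have vE (j : 'I_n) : v'`_j = w j.
    by rewrite (nth_map j) ?size_enum_ord // nth_ord_enum.
  rewrite -sv'; apply: Hmax.
    move=> c Hc i Hi; rewrite sv' in Hi.
    apply: (iw (fun i => c`_i) _ (Ordinal Hi)); apply: etrans Hc; rewrite /zcomb sv'.
    by apply: eq_bigr => j _; rewrite vE.
  by move=> i Hi; rewrite sv' in Hi; rewrite (vE (Ordinal Hi)).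
split.
  pose v' := [seq w i | i <- enum 'I_r].
  have sv' : size v' = r by rewrite size_map size_enum_ord.
  have vE (j : 'I_r) : v'`_j = w j.
    by rewrite (nth_map j) ?size_enum_ord // nth_ord_enum.
  exists v'; split=> // [c Hc i Hi|i Hi]; rewrite sv' in Hi.
    apply: (iw (fun i => c`_i) _ (Ordinal Hi)); apply: etrans Hc; rewrite /zcomb sv'.
    by apply: eq_bigr => j _; rewrite vE.
  by rewrite (vE (Ordinal Hi)).
move=> v /zindep_indep iv Hv; apply: (Hmax _ _ iv) => i; exact: Hv.
Qed.

Lemma rank_is_uniq H r r' : rank_is H r -> rank_is H r' -> r = r'.
Proof.
move=> [[w [iw Hw]] Hm] [[w' [iw' Hw']] Hm']; apply/eqP.
by rewrite eqn_leq (Hm' _ _ iw Hw) (Hm _ _ iw' Hw').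
Qed.

Lemma rank_is_nil : rank_is (in_span [::]) 0.
Proof.
split; first by exists (fun _ => 0); split=> [c _ []|[]].
move=> [|n] w iw Hw //.
have H1 : \sum_i w i *~ 1 = 0.
  by rewrite big1 // => i _; have /in_span_nil -> := Hw i; rewrite mul0rz.
by have /eqP := iw (fun _ => 1) H1 ord0; rewrite oner_eq0.
Qed.

(** If [k a] lies in [H], multiplication by [k] carries an independent family of [K] to one of [H].
    If [a] has infinite order modulo [H], one step of Gaussian elimination removes [a] at the cost
    of one vector. *)
Lemma rank_is_add H K a r : subgroup H -> rank_is H r ->
  (forall x, K x <-> exists c y, H y /\ x = a *~ c + y) ->
  rank_is K (r + ~~ `[< sat H a >]).
Proof.
move=> sH [[w [iw Hw]] Hmax] KE.
case: (asboolP (sat H a)) => [[k [k0 Hk]]|nsat]; split.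
- rewrite addn0; exists w; split=> // i; apply/KE; exists 0, (w i).
  by rewrite mulr0z add0r.
- rewrite addn0 => n v iv Kv; apply: (Hmax _ (fun i => v i *+ k)).
    move=> c Hc i; have Hck : \sum_j v j *~ (c j *+ k) = 0.
      transitivity (\sum_j v j *+ k *~ c j); last exact: Hc.
      apply: eq_bigr => j _.
      by rewrite -mulr_natr natz mulrzA mulrzAC -pmulrn.
    move/eqP: (iv _ Hck i).
    by rewrite mulrn_eq0 (negbTE (lt0n_neq0 k0)) => /eqP.
  move=> i; have /KE[c [y [Hy ->]]] := Kv i.
  rewrite mulrnDl; apply: subgroupD => //; last exact: subgroupMn.
  by rewrite pmulrn mulrzAC -pmulrn; apply: subgroupMz.
- rewrite addn1; exists (fun i => if unlift ord0 i is Some j then w j else a).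
  split; last first.
    move=> i; apply/KE; case: unliftP => [j|] _.
      by exists 0, (w j); rewrite mulr0z add0r.
    by exists 1, 0; rewrite mulr1z addr0; split=> //; case: sH.
  move=> c; rewrite big_ord_recl unlift_none.
  under eq_bigr do rewrite liftK.
  move=> Hc; have c0 : c ord0 = 0.
    apply: contra_notP nsat => /eqP c0; apply: (satMz sH c0).
    rewrite -[_ *~ _]opprK (addr0_eq Hc) -sumrN; apply: subgroup_sum => // i _.
    by apply: subgroupN => //; apply: subgroupMz.
  move: Hc; rewrite c0 mulr0z add0r => /iw Hc i.
  by case: (unliftP ord0 i) => [j|] ->.
- rewrite addn1 => -[|n] v iv Kv //; rewrite ltnS.
  have /choice[cy Hcy] i : exists cy : int * V, H cy.2 /\ v i = a *~ cy.1 + cy.2.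
    by have /KE[c [y Hy]] := Kv i; exists (c, y).
  pose c i := (cy i).1.
  (* The vector [v i0] serves as pivot; without a pivot the whole family already lies in [H]. *)
  have [[i0 ci0]|c0] := pselect (exists i, c i != 0); last first.
    apply: ltnW; apply: (Hmax _ _ iv) => i; have [Hy ->] := Hcy i.
    rewrite -/(c i); have [->|ci] := eqVneq (c i) 0; first by rewrite mulr0z add0r.
    by case: c0; exists i.
  apply: (Hmax _ (fun j => v (lift i0 j) *~ c i0 - v i0 *~ c (lift i0 j))).
    (* A relation [d] among the eliminated vectors is rewritten as a relation [e] among the [v i];
       its entry [c i0 * d j] forces [d j = 0]. *)
    move=> d Hd j; pose e i := if unlift i0 i is Some j then c i0 * d j
      else - \sum_j c (lift i0 j) * d j.
    have He : \sum_i v i *~ e i = 0.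
      apply: etrans Hd; rewrite (bigD1_ord i0) //= {1}/e unlift_none.
      under eq_bigr do rewrite /e liftK mulrzA.
      under [in RHS]eq_bigr do rewrite mulrzBl -!mulrzA.
      rewrite sumrB addrC; congr (_ + _).
        by apply: eq_bigr => i _; rewrite mulrzA.
      rewrite mulrNz; congr (- _); exact: (raddf_sum (intmul (v i0))).
    move/eqP: (iv e He (lift i0 j)).
    by rewrite /e liftK mulf_eq0 (negbTE ci0) => /eqP.
  move=> j; have [Hy ->] := Hcy (lift i0 j); have [Hy0 ->] := Hcy i0.
  rewrite -/(c _) -/(c i0) !mulrzDl -!mulrzA [c i0 * _]mulrC opprD addrACA subrr add0r.
  by apply: sH.2; apply: subgroupMz.
Qed.

Lemma rank_is_span s : exists r, rank_is (in_span s) r.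
Proof.
elim: s => [|a s [r IH]]; first by exists 0%N; apply: rank_is_nil.
eexists; apply: (rank_is_add (subgroup_span s) IH) => x; exact: in_span_cons.
Qed.

Lemma zrankP s : rank_is (in_span s) (zrank s).
Proof.
apply/is_rankE; have [r Hr] := rank_is_span s.
by apply: ClassicalEpsilon.epsilon_spec; exists r; apply/is_rankE.
Qed.

Lemma zrank_uniq s r : rank_is (in_span s) r -> zrank s = r.
Proof. exact: rank_is_uniq (zrankP s). Qed.

End Subgroups.

(** * Homomorphisms on the torsion of a quotient *)

(** Euclidean division by the least positive element, which is [d]; the trivial subgroup has
    [d = 0]. *)
Lemma int_subgroup (I : int -> Prop) :
  subgroup I -> exists d, forall c, I c <-> (d %| c)%Z.
Proof.
move=> sI.
have mulI c q : I c -> I (q * c) by rewrite mulrC -mulrzz; apply: subgroupMz.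
have [[c [c0 Ic]]|noI] := pselect (exists c, c != 0 /\ I c); last first.
  exists 0 => c; rewrite dvd0z; split=> [Ic|/eqP->]; last by case: sI.
  by apply: contra_notT noI => c0; exists c.
have exP : exists n, (0 < n)%N && `[< I n%:Z >].
  exists `|c|%N; rewrite absz_gt0 c0 /=; apply/asboolP.
  by rewrite abszEsign; apply: mulI.
case: (ex_minnP exP) => d /andP[d0 /asboolP Id] dmin.
exists d%:Z => e; split=> [Ie|/dvdzP[q ->]]; last exact: mulI.
have Im : I (e %% d)%Z.
  have -> : (e %% d)%Z = e - (e %/ d)%Z * d by rewrite {2}(divz_eq e d) addrC addKr.
  by apply: sI.2 => //; apply: mulI.
have dn0 : d%:Z != 0 by rewrite -lt0n.
have m0 := modz_ge0 e dn0.
have md := ltz_mod e dn0.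
apply/dvdz_mod0P; move: m0 md Im; case: (e %% d)%Z => // [[|m]] // _ md Im.
have: (m.+1 < d)%N by lia.
by rewrite ltnNge dmin //; apply/asboolP.
Qed.

(** Induction on the generators: the coefficients that [a] can have in elements of [P] form an ideal
    generated by some [d]. One element of [P] with coefficient [d], together with generators of the
    part of [P] inside the span of [s], generates [P]. *)
Lemma subgroup_fg (V : zmodType) (s : seq V) (P : V -> Prop) :
  subgroup P -> (forall x, P x -> in_span s x) ->
  exists t, forall x, P x <-> in_span t x.
Proof.
elim: s P => [|a s IH] P sP Ps.
  exists [::] => x; split; first exact: Ps.
  by move=> /in_span_nil ->; case: sP.
have ss := subgroup_span s.
have [||t tE] := IH (fun x => P x /\ in_span s x).
- by split=> [|x y [? ?] [? ?]]; split; try (by case: sP); try (by case: ss);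
    [apply: sP.2 | apply: ss.2].
- by move=> x [].
have [|d dE] := @int_subgroup (fun c => exists y, in_span s y /\ P (a *~ c + y)).
  split; first by exists 0; rewrite mulr0z addr0; split; [case: ss|case: sP].
  move=> c c' [y [Hy Py]] [y' [Hy' Py']]; exists (y - y'); split; first exact: ss.2.
  by rewrite mulrzBr addrACA -opprD; apply: sP.2.
have [y0 [Hy0 Pb]] : exists y, in_span s y /\ P (a *~ d + y) by apply/dE.
exists (a *~ d + y0 :: t) => x; split=> [Px|/in_span_cons[q [y [/tE[Py _] ->]]]].
  have /in_span_cons[c [y [Hy xE]]] := Ps x Px.
  have /dvdzP[q cE] : (d %| c)%Z by apply/dE; exists y; rewrite -xE.
  apply/in_span_cons; exists q, (x - (a *~ d + y0) *~ q); rewrite [RHS]addrC subrK.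
  split=> //; apply/tE; split; first by apply: sP.2 => //; apply: subgroupMz.
  rewrite xE cE mulrzDl -mulrzA [d * q]mulrC opprD addrACA subrr add0r.
  by apply: ss.2 => //; apply: subgroupMz.
by apply: subgroupD => //; apply: subgroupMz.
Qed.

(** * Extension of additive maps into a divisible group *)

Section AdditiveOn.
Variables (V G : zmodType).
Implicit Types (P : V -> Prop) (f : V -> G).

Definition additive_on P f := forall x y, P x -> P y -> f (x + y) = f x + f y.

Lemma additive_on0 P f : subgroup P -> additive_on P f -> f 0 = 0.
Proof.
move=> [P0 _] fD; have := fD _ _ P0 P0; rewrite addr0 => /(congr1 (+%R (- f 0))).
by rewrite addKr addNr.
Qed.

Lemma additive_onB P f x y : subgroup P -> additive_on P f -> P x -> P y ->
  f (x - y) = f x - f y.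
Proof.
move=> sP fD Px Py; have Pxy : P (x - y) by exact: sP.2.
by rewrite -[in RHS](subrK y x) (fD (x - y) y) ?addrK.
Qed.

Lemma additive_onMn P f x n : subgroup P -> additive_on P f -> P x ->
  f (x *+ n) = f x *+ n.
Proof.
move=> sP fD Px; elim: n => [|n IH]; first by rewrite !mulr0n (additive_on0 sP).
by rewrite !mulrS fD ?IH //; apply: subgroupMn.
Qed.

Lemma additive_onMz P f x c : subgroup P -> additive_on P f -> P x ->
  f (x *~ c) = f x *~ c.
Proof.
move=> sP fD Px; case: c => n; first exact: (additive_onMn n sP).
rewrite NegzE !mulrNz -[- _ in LHS]sub0r (additive_onB sP) //.
- by rewrite (additive_on0 sP) // sub0r (additive_onMn _ sP).
- by case: sP.
- exact: subgroupMn.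
Qed.

Lemma divisibleMz (w : G) (d : int) : divisible G -> d != 0 -> exists z, z *~ d = w.
Proof.
move=> divG d0; have [|z zw] := divG `|d|%N _ w; first by rewrite absz_gt0.
exists (z *~ sgz d); rewrite -mulrzA -zw [in RHS]pmulrn; congr (_ *~ _).
by rewrite -abszEsg.
Qed.

(** The multiples of [g] inside [P] are those of [g *~ d]. Divisibility yields [y] with
    [y *~ d = f (g *~ d)], and [g] is sent to [y]; for [d = 0] any value would do and [0] is
    taken. *)
Lemma divisible_extend1 P f g : divisible G -> subgroup P -> additive_on P f ->
  exists f', (forall x, P x -> f' x = f x) /\
    additive_on (fun x => exists p c, P p /\ x = p + g *~ c) f'.
Proof.
move=> divG sP fD.
have [|d dE] := @int_subgroup (fun c => P (g *~ c)).
  split; first by case: sP.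
  by move=> c c' Pc Pc'; rewrite mulrzBr; apply: sP.2.
have [y yE] : exists y, forall c, P (g *~ c) -> f (g *~ c) = y *~ c.
  have [d0|d0] := eqVneq d 0.
    exists 0 => c /dE; rewrite d0 dvd0z => /eqP->.
    by rewrite !mulr0z (additive_on0 sP).
  have [y ydE] := divisibleMz (f (g *~ d)) divG d0.
  exists y => c /dE/dvdzP[q ->]; rewrite mulrC !mulrzA ydE.
  by rewrite (additive_onMz _ sP) //; apply/dE.
pose Q x := exists p c, P p /\ x = p + g *~ c.
(* The value [f p + y *~ c] does not depend on the decomposition [p + g *~ c]; outside [Q] the value
   is an arbitrary [0]. *)
have /choice[f' f'E] x : exists v, Q x ->
    forall p c, P p -> x = p + g *~ c -> v = f p + y *~ c.
  have [[p [c [Pp xE]]]|nQ] := pselect (Q x); last by exists 0.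
  exists (f p + y *~ c) => _ p' c' Pp' xE'.
  have gE : p - p' = g *~ (c' - c).
    apply/eqP; rewrite mulrzBr subr_eq addrAC eq_sym subr_eq eq_sym -xE addrC xE'.
    by rewrite addrC.
  have := additive_onB sP fD Pp Pp'; rewrite gE yE; last by rewrite -gE; apply: sP.2.
  rewrite mulrzBr => /eqP; rewrite subr_eq addrAC eq_sym subr_eq => /eqP fE.
  by rewrite fE addrC.
exists f'; split=> [x Px|].
  rewrite (f'E x _ x 0) ?mulr0z ?addr0 //; exists x, 0.
  by rewrite mulr0z addr0.
move=> _ _ [p [c [Pp ->]]] [p' [c' [Pp' ->]]].
have Qx : Q (p + g *~ c) by exists p, c.
have Qy : Q (p' + g *~ c') by exists p', c'.
have Exy : p + g *~ c + (p' + g *~ c') = p + p' + g *~ (c + c').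
  by rewrite mulrzDr addrACA.
have Pxy : P (p + p') by apply: subgroupD.
have Qxy : Q (p + g *~ c + (p' + g *~ c')) by rewrite Exy; exists (p + p'), (c + c').
rewrite (f'E _ Qx p c) // (f'E _ Qy p' c') // (f'E _ Qxy (p + p') (c + c')) //.
by rewrite mulrzDr fD // addrACA.
Qed.

(** Divisible groups are injective; since [V] is finitely generated, the extension proceeds one
    generator at a time. *)
Lemma divisible_extension P f : fingen V -> divisible G -> subgroup P ->
  additive_on P f ->
  exists f', (forall x, P x -> f' x = f x) /\ forall x y, f' (x + y) = f' x + f' y.
Proof.
move=> [gens genV] divG sP fD.
suff [f' [f'E f'D]] : exists f', (forall x, P x -> f' x = f x) /\
    additive_on (addg P (in_span gens)) f'.
  by exists f'; split=> // x y; apply: f'D; apply: addgr.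
elim: (gens) => [|g s [f1 [f1E f1D]]].
  exists f; split=> // _ _ [x [_ [Px /in_span_nil-> ->]]] [y [_ [Py /in_span_nil-> ->]]].
  by rewrite !addr0 fD.
have sPs := subgroup_addg sP (subgroup_span s).
have [f2 [f2E f2D]] := divisible_extend1 g divG sPs f1D.
exists f2; split=> [x Px|].
  by rewrite f2E ?f1E //; apply: addgl => //; apply: subgroup_span.
have sub x : addg P (in_span (g :: s)) x ->
    exists p c, addg P (in_span s) p /\ x = p + g *~ c.
  move=> [y [_ [Py /in_span_cons[c [z [sz ->]]] ->]]].
  by exists (y + z), c; rewrite addrCA [RHS]addrC; split=> //; exists y, z.
by move=> x y /sub Hx /sub Hy; apply: f2D.
Qed.
End AdditiveOn.

(** * Torsion homomorphisms and their number *)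

Section Torhom.
Variables (V G : zmodType).
Implicit Types (H K : V -> Prop) (f : V -> G).

(* At H = in_span s, the notions sat, torhom and homcnt below are convertible to
   in_sat s, is_torhom s and hom_count_is s. *)
Definition torhom H f :=
  (forall x y, sat H x -> sat H y -> f (x + y) = f x + f y) /\
  (forall x, H x -> f x = 0).

(** Each class of torsion homs, up to agreement on [sat H], is hit exactly once. The index type is
    left free so that products and subtypes can serve as indices. *)
Definition enumerates H (T : Type) (F : T -> V -> G) :=
  [/\ forall i, torhom H (F i),
      forall i j, (forall x, sat H x -> F i x = F j x) -> i = j &
      forall f, torhom H f -> exists i, forall x, sat H x -> f x = F i x].

Definition homcnt H n := exists F : 'I_n -> V -> G, enumerates H F.

Lemma torhom0 H f : subgroup H -> torhom H f -> f 0 = 0.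
Proof. by move=> [H0 _] [_]; apply. Qed.

Lemma torhomMn H f x n : subgroup H -> torhom H f -> sat H x ->
  f (x *+ n) = f x *+ n.
Proof.
by move=> sH [fD _]; apply: (additive_onMn _ (subgroup_sat sH) fD).
Qed.

Lemma torhomB H f x y : subgroup H -> torhom H f -> sat H x -> sat H y ->
  f (x - y) = f x - f y.
Proof.
by move=> sH [fD _]; apply: (additive_onB (subgroup_sat sH) fD).
Qed.

Lemma torhom_eq_gen H f f' t : subgroup H -> torhom H f -> torhom H f' ->
  (forall x, sat H x -> in_span t x) ->
  (forall x, x \in t -> sat H x /\ f x = f' x) ->
  forall x, sat H x -> f x = f' x.
Proof.
move=> sH tf tf' tgen Ht x Hx; have sS := subgroup_sat sH.
suff [] : sat H x /\ f x = f' x by [].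
apply: (span_min (H := fun x => sat H x /\ f x = f' x) _ Ht (tgen x Hx)).
split; first by rewrite !(torhom0 sH) //; split=> //; case: sS.
move=> y z [Hy fy] [Hz fz]; rewrite !(torhomB sH) // fy fz; split=> //.
exact: sS.2.
Qed.

Lemma torhom_sub H K f : (forall x, H x -> K x) -> torhom K f -> torhom H f.
Proof.
move=> HK [fD f0]; split=> [x y Hx Hy|x Hx]; last exact/f0/HK.
by apply: fD; [apply: sat_mono Hx | apply: sat_mono Hy].
Qed.

Lemma homcntT H (T : finType) (F : T -> V -> G) :
  enumerates H F -> homcnt H #|T|.
Proof.
move=> [tF iF sF]; exists (fun i => F (enum_val i)); split=> [i|i j e|f tf] //.
  exact/enum_val_inj/iF.
by have [i Hi] := sF f tf; exists (enum_rank i); rewrite enum_rankK.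
Qed.

Lemma homcnt_uniq H n m : homcnt H n -> homcnt H m -> n = m.
Proof.
suff le n' m' : homcnt H n' -> homcnt H m' -> (n' <= m')%N.
  by move=> h h'; apply/eqP; rewrite eqn_leq !le.
move=> [F [tF iF sF]] [F' [tF' iF' sF']].
have /choice[g gE] i := sF' _ (tF i).
rewrite -[n']card_ord -[m']card_ord; apply: (leq_card g) => i j e.
by apply: iF => x Hx; rewrite !gE // e.
Qed.

(** The classes of torsion homs correspond to the attained codes, of which there are finitely many;
    the zero map attains one. *)
Lemma homcnt_code H (T : finType) (code : (V -> G) -> T) :
  (forall f f', torhom H f -> torhom H f' ->
     code f = code f' <-> forall x, sat H x -> f x = f' x) ->
  exists n, (0 < n)%N /\ homcnt H n.
Proof.
move=> codeP.
pose P c := `[< exists f, torhom H f /\ code f = c >].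
pose T' := {c : T | P c}.
have /choice[F FP] (c : T') : exists f, torhom H f /\ code f = val c.
  by case: c => c /= /asboolP.
have t0 : torhom H (fun=> 0) by split=> // *; rewrite addr0.
have p0 : P (code (fun=> 0)).
  by apply/asboolP; exists (fun=> 0).
exists #|{: T'}|; split; first by apply/card_gt0P; exists (exist P _ p0 : T').
apply: (@homcntT _ _ F); split=> [c|c c' e|f tf].
- by case: (FP c).
- apply/val_inj; have [tc <-] := FP c; have [tc' <-] := FP c'.
  exact/(codeP _ _ tc tc').
- have pf : P (code f).
    by apply/asboolP; exists f.
  exists (exist P _ pf); have [tc ec] := FP (exist P _ pf).
  exact/(codeP _ _ tf tc).
Qed.

(** A finite list [t] generates [sat H], and some [N > 0] multiplies all of [t] into [H]. A torsion
    hom is determined by its values on [t], which lie in the finite group [G[N]]. *)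
Lemma homcnt_exists H : fingen V -> torsionwise_finite G -> subgroup H ->
  exists n, (0 < n)%N /\ homcnt H n.
Proof.
move=> [gens genV] finG sH; have sS := subgroup_sat sH.
have [t tE] := subgroup_fg sS (fun x _ => genV x).
have [N [N0 tN]] : exists N, (0 < N)%N /\ forall x, x \in t -> H (x *+ N).
  have : forall x, x \in t -> sat H x by move=> x /mem_in_span/tE.
  elim: (t) => [|a u IH] Hu; first by exists 1.
  have [|N [N0 HN]] := IH; first by move=> x xu; apply: Hu; rewrite inE xu orbT.
  have [|k [k0 Hk]] := Hu a; first exact: mem_head.
  exists (k * N)%N; rewrite muln_gt0 k0 N0; split=> // x; rewrite inE => /orP[/eqP->|xu].
    by rewrite mulrnA; apply: subgroupMn.
  by rewrite mulnC mulrnA; apply: subgroupMn => //; apply: HN.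
have [s sP] := finG N N0.
(* The code records where each [f t_i] stands in the list [s] covering [G[N]]; [index] may return
   [size s], hence the successor. *)
apply: (@homcnt_code _ {ffun 'I_(size t) -> 'I_(size s).+1}
  (fun f => [ffun i : 'I_(size t) => inord (index (f t`_i) s)])).
move=> f f' tf tf'; split=> [/ffunP e|e]; last first.
  apply/ffunP => i; rewrite !ffunE e //; exact/tE/mem_in_span/mem_nth.
apply: (torhom_eq_gen (t := t)) => // [x /tE //|_ /(nthP 0)[i it <-]].
have sti : sat H t`_i by apply/tE/mem_in_span/mem_nth.
split=> //; have /(congr1 val) := e (Ordinal it); rewrite !ffunE /=.
have fs g : torhom H g -> g t`_i \in s.
  by move=> tg; apply: sP; rewrite -(torhomMn N sH) // tg.2 //; apply/tN/mem_nth.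
rewrite !inordK ?ltnS ?index_size // => eI.
by rewrite -[LHS](nth_index 0 (fs _ tf)) eI nth_index ?fs.
Qed.

(** Between [H] and [sat H] the saturation does not change, so the torsion homs of [K] are those of
    [H] that vanish on [K]. *)
Lemma homcnt_sub H K n (F : 'I_n -> V -> G) : subgroup H ->
  (forall x, H x -> K x) -> (forall x, K x -> sat H x) -> enumerates H F ->
  homcnt K #|[pred i | `[< torhom K (F i) >]]|.
Proof.
move=> sH HK KH [tF iF sF].
have satE x : sat K x <-> sat H x.
  by split=> [/(sat_mono KH)/sat_sat|]; last exact: sat_mono.
pose P i := `[< torhom K (F i) >].
pose T := {i : 'I_n | P i}.
rewrite -(card_sig P).
apply: (@homcntT _ _ (fun i : T => F (val i))); split=> [[i /= /asboolP] //|i j e|f tf].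
  by apply/val_inj/iF => x /satE; apply: e.
have [i Hi] := sF f (torhom_sub HK tf).
have ti : P i.
  apply/asboolP; split=> [x y Hx Hy|x Hx].
    by apply: (tF i).1; apply/satE.
  by rewrite -Hi ?tf.2 //; apply: KH.
by exists (exist P i ti) => x /satE; apply: Hi.
Qed.

End Torhom.

Lemma torhom_mod_eq (V G : zmodType) (H : V -> Prop) (f : V -> G) x y :
  subgroup H -> torhom H f -> sat H x -> H (x - y) -> f x = f y.
Proof.
move=> sH tf Hx Hxy; have Hy : sat H y.
  rewrite -[y](subKr x); apply: (subgroup_sat sH).2 => //; exact: sub_sat.
by apply/eqP; rewrite -subr_eq0 -(torhomB sH tf) // tf.2.
Qed.

(** Extending [f] by zero on [K] is consistent because [sat H] meets [K] inside [H]; divisibility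
    then extends the map from [sat H + K] to all of [V]. *)
Lemma torhom_extension (V G : zmodType) (H K : V -> Prop) (f : V -> G) :
  fingen V -> divisible G -> subgroup H -> subgroup K ->
  (forall x, sat H x -> K x -> H x) -> torhom H f ->
  exists f', torhom K f' /\ forall x, sat H x -> f' x = f x.
Proof.
move=> fgV divG sH sK HK tf; have sS := subgroup_sat sH.
have /choice[f0 f0E] x : exists v, addg (sat H) K x ->
    forall y z, sat H y -> K z -> x = y + z -> v = f y.
  have [[y [z [Hy Kz xE]]]|nQ] := pselect (addg (sat H) K x); last by exists 0.
  exists (f y) => _ y' z' Hy' Kz' xE'.
  apply: (torhom_mod_eq sH tf) => //; apply: HK; first exact: sS.2.
  have -> : y - y' = z' - z; last exact: sK.2.
  by apply/eqP; rewrite subr_eq addrAC eq_sym subr_eq -xE xE' addrC.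
have sQ := subgroup_addg sS sK.
have f0D : additive_on (addg (sat H) K) f0.
  move=> x x' Qx Qx'; have [y [z [Hy Kz xE]]] := Qx; have [y' [z' [Hy' Kz' xE']]] := Qx'.
  rewrite (f0E _ Qx y z) // (f0E _ Qx' y' z') //.
  rewrite (f0E _ (subgroupD sQ Qx Qx') (y + y') (z + z')) //.
  - exact: tf.1.
  - exact: subgroupD.
  - exact: subgroupD.
  - by rewrite xE xE' addrACA.
have [f' [f'E f'D]] := divisible_extension fgV divG sQ f0D.
exists f'; split; first split=> [x y _ _|x Kx]; first exact: f'D.
  have Qx : addg (sat H) K x by apply: addgr.
  rewrite f'E // (f0E _ Qx 0 x) ?add0r // ?(torhom0 sH) //; by case: sS.
move=> x Hx; have Qx : addg (sat H) K x by apply: addgl.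
by rewrite f'E // (f0E _ Qx x 0) ?addr0 //; case: sK.
Qed.

(** The torsion of [V/H] embeds into that of [V/K], with quotient the torsion of [V/(K + sat H)].
    Restriction of torsion homs from [K] to [H] is onto by extension, and its fibres are cosets of
    the homs that also kill [sat H]. *)
Lemma homcnt_mul (V G : zmodType) (H K : V -> Prop) n m :
  fingen V -> divisible G -> subgroup H -> subgroup K ->
  (forall x, H x -> K x) -> (forall x, sat H x -> K x -> H x) ->
  homcnt G H n -> homcnt G (addg K (sat H)) m -> homcnt G K (n * m)%N.
Proof.
move=> fgV divG sH sK HK KH [F [tF iF sF]] [F' [tF' iF' sF']].
have sS := subgroup_sat sH.
have KL x : K x -> addg K (sat H) x by apply: addgl.
have satL x : sat (addg K (sat H)) x <-> sat K x.
  split; last exact: sat_mono.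
  move/(sat_mono (H' := sat K)) => h; apply/sat_sat/h => y.
  by apply: addg_min; [exact: subgroup_sat|exact: sub_sat|move=> z; exact: sat_mono].
(* One extension [E i] is fixed for each hom of [H]; every hom of [K] is then uniquely some [E i]
   plus some [F' j]. *)
have /choice[E EP] i : exists f', torhom K f' /\ forall x, sat H x -> f' x = F i x.
  exact: torhom_extension.
have F'0 j x : sat H x -> F' j x = 0.
  by move=> Hx; apply: (tF' j).2; apply: addgr.
have -> : (n * m)%N = #|{: 'I_n * 'I_m}| by rewrite card_prod !card_ord.
apply: (@homcntT _ _ _ _ (fun ij x => E ij.1 x + F' ij.2 x)).
split=> [[i j]|[i j] [i' j'] /= e|f tf] /=.
- have [[ED E0] _] := EP i; have [F'D F'K] := tF' j.
  split=> [x y Kx Ky|x Kx]; last by rewrite (E0 x Kx) (F'K x (KL x Kx)) addr0.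
  by rewrite (ED _ _ Kx Ky) (F'D _ _ ((satL x).2 Kx) ((satL y).2 Ky)) addrACA.
- have ii' : i = i'.
    apply: iF => x Hx; rewrite -!(EP _).2 // -[LHS]addr0 -[RHS]addr0.
    by rewrite -{1}(F'0 j x) // -(F'0 j' x) // e //; apply: sat_mono Hx.
  subst i'; congr (_, _); apply: iF' => x /satL Kx.
  exact: (addrI (E i x)) (e x Kx).
- have [i Hi] := sF f (torhom_sub HK tf); have [tE EE] := EP i.
  have [|j Hj] := sF' (fun x => f x - E i x).
    split=> [x y /satL Kx /satL Ky|]; first by rewrite tf.1 // tE.1 // opprD addrACA.
    move=> _ [x [y [Kx Hy ->]]]; have Ky := sat_mono HK Hy.
    have Kx' := sub_sat Kx.
    rewrite (tf.1 _ _ Kx' Ky) (tE.1 _ _ Kx' Ky) (tf.2 _ Kx) (tE.2 _ Kx) !add0r.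
    by rewrite EE // Hi // subrr.
  exists (i, j) => x Kx /=; rewrite -Hj; last exact/satL.
  by rewrite addrC subrK.
Qed.

(** * Transport along maps that are additive modulo a subgroup *)

Section Transport.
Variables (V W G : zmodType) (H : V -> Prop) (K : W -> Prop) (b : W -> V).
Hypotheses (sH : subgroup H) (sK : subgroup K).
Hypotheses (bD : forall x y, H (b (x + y) - (b x + b y))).
Hypotheses (bK : forall y, K y -> H (b y)).

Lemma sat_transport y : sat K y -> sat H (b y).
Proof.
have bMn n : H (b (y *+ n.+1) - b y *+ n.+1).
  elim: n => [|n IH]; first by rewrite !mulr1n subrr; case: sH.
  rewrite ![_ *+ n.+2]mulrS.
  have -> : b (y + y *+ n.+1) - (b y + b y *+ n.+1) =
      b (y + y *+ n.+1) - (b y + b (y *+ n.+1)) + (b (y *+ n.+1) - b y *+ n.+1).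
    by rewrite !opprD !addrA subrK.
  exact: subgroupD.
move=> [[|k] [// _ Hk]]; exists k.+1; split=> //.
rewrite -[b y *+ _](subKr (b (y *+ k.+1))).
by apply: sH.2 => //; apply: bK.
Qed.

Lemma torhom_transport (f : V -> G) : torhom H f -> torhom K (fun y => f (b y)).
Proof.
move=> tf; split=> [x y Kx Ky|x Kx]; last exact/tf.2/bK.
rewrite -(tf.1 _ _ (sat_transport Kx) (sat_transport Ky)).
apply: (torhom_mod_eq sH tf) => //; apply: sat_transport.
by apply: subgroupD => //; apply: subgroup_sat.
Qed.
End Transport.

(** The maps [a] and [b] induce inverse isomorphisms between the torsion of [V/H] and that of [W/K].
    Additivity is asked only modulo the subgroups, so a set-theoretic section is admissible. *)
Lemma homcnt_equiv (V W G : zmodType) (H : V -> Prop) (K : W -> Prop)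
    (a : V -> W) (b : W -> V) n : subgroup H -> subgroup K ->
  (forall x y, K (a (x + y) - (a x + a y))) -> (forall x, H x -> K (a x)) ->
  (forall x y, H (b (x + y) - (b x + b y))) -> (forall y, K y -> H (b y)) ->
  (forall x, sat H x -> H (x - b (a x))) ->
  (forall y, sat K y -> K (y - a (b y))) ->
  homcnt G H n -> homcnt G K n.
Proof.
move=> sH sK aD aK bD bK baH abK [F [tF iF sF]].
exists (fun i y => F i (b y)); split=> [i|i j e|f tf].
- exact: (torhom_transport sH).
- apply: iF => x Hx; have Hd := baH x Hx.
  rewrite (torhom_mod_eq sH (tF i) Hx Hd) (torhom_mod_eq sH (tF j) Hx Hd).
  by apply: e; exact: sat_transport Hx.
- have [i Hi] := sF _ (torhom_transport sK sH aD aK tf).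
  exists i => y Ky; rewrite -Hi; last exact: sat_transport Ky.
  exact: (torhom_mod_eq sK tf Ky (abK y Ky)).
Qed.

(** * Inclusion-exclusion and transposition *)

Lemma exprD_subsets (R : comRingType) (I : finType) (A : {set I}) (a b : R) :
  (a + b) ^+ #|A| = \sum_(J : {set I} | J \subset A) a ^+ #|J| * b ^+ #|A :\: J|.
Proof.
(* Outside [A] the factor is [0 + 1], so only the subsets of [A] survive in the expanded product. *)
pose p i : R := if i \in A then a else 0.
pose q i : R := if i \in A then b else 1.
have -> : (a + b) ^+ #|A| = \prod_i (p i + q i).
  rewrite -prodr_const [LHS]big_mkcond; apply: eq_bigr => i _.
  by rewrite /p /q; case: ifP; rewrite ?add0r.
rewrite bigA_distr [RHS]big_mkcond; apply: eq_bigr => J _.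
case: ifPn => [JA|/subsetPn[i iJ iA]]; last first.
  by rewrite (bigD1 i) //= iJ /p (negbTE iA) mul0r.
rewrite -!prodr_const (bigID (mem J)) /=; congr (_ * _).
  by apply: eq_bigr => i iJ; rewrite iJ /p (subsetP JA).
rewrite big_mkcond [RHS]big_mkcond; apply: eq_bigr => i _.
by rewrite inE /q; case: (i \in J); case: (i \in A).
Qed.

Section Hull.
Variables (V : zmodType) (I : finType) (e : I -> V).
Implicit Types (H K : V -> Prop) (S T : {set I}).

(** The subgroup generated by [H] and the [e i] with [i] in [S]. *)
Definition hull H S x := exists c : I -> int, H (x - \sum_(i in S) e i *~ c i).

Lemma subgroup_hull H S : subgroup H -> subgroup (hull H S).
Proof.
move=> sH; split.
  exists (fun=> 0); rewrite big1 ?subr0; first by case: sH.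
  by move=> i _; rewrite mulr0z.
move=> x y [c Hc] [d Hd]; exists (fun i => c i - d i).
under eq_bigr do rewrite mulrzBr.
rewrite sumrB; have := sH.2 _ _ Hc Hd; congr H.
by rewrite !opprD !opprK addrACA.
Qed.

Lemma sub_hull H S x : H x -> hull H S x.
Proof.
by move=> Hx; exists (fun=> 0); rewrite big1 ?subr0 // => i _; rewrite mulr0z.
Qed.

Lemma mem_hull H S i : subgroup H -> i \in S -> hull H S (e i).
Proof.
move=> [H0 _] iS; exists (fun j => (j == i)%:R).
rewrite (bigD1 i) //= eqxx mulr1z big1 ?addr0 ?subrr // => j /andP[_ /negbTE->].
by rewrite mulr0z.
Qed.

Lemma hull_min H S K : subgroup K -> (forall x, H x -> K x) ->
  (forall i, i \in S -> K (e i)) -> forall x, hull H S x -> K x.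
Proof.
move=> sK HK SK x [c Hc]; rewrite -(subrK (\sum_(i in S) e i *~ c i) x).
apply: subgroupD => //; first exact: HK.
by apply: subgroup_sum => // i iS; apply: subgroupMz => //; apply: SK.
Qed.

(** After exchanging the sums, [i] contributes [(1 - 1)] to the power of the size of [T :&: Z i];
    the total is the number of [i] with [Z i] disjoint from [T]. *)
Lemma alternating_count_ge0 n (T : {set I}) (Z : 'I_n -> {set I}) :
  0 <= \sum_(S : {set I} | S \subset T)
         (-1) ^+ #|S| * (#|[pred i | S \subset Z i]|)%:Z.
Proof.
have -> : \sum_(S : {set I} | S \subset T)
    (-1) ^+ #|S| * (#|[pred i | S \subset Z i]|)%:Z =
  \sum_i \sum_(S : {set I} | S \subset T :&: Z i) (-1) ^+ #|S|.
  transitivity (\sum_(S : {set I} | S \subset T) \sum_(i | S \subset Z i)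
      (-1) ^+ #|S| : int).
    by apply: eq_bigr => S _; rewrite sumr_const -mulr_natr natz.
  rewrite (exchange_big_dep predT) //=; apply: eq_bigr => i _.
  by apply: eq_bigl => S; rewrite subsetI.
apply: sumr_ge0 => i _; have := exprD_subsets (T :&: Z i) (-1 : int) 1.
under eq_bigr do rewrite expr1n mulr1.
by move=> <-; rewrite addNr; case: #|_| => [|m]; rewrite ?expr0 ?exprS ?mul0r.
Qed.

(** As the [e i] with [i] in [T] are torsion modulo [H], the homs of [hull H S] are the homs of [H]
    that kill [e i] for [i] in [S]. The alternating sum counts those killing no [e i] with [i] in
    [T]. *)
Lemma alternating_hull_ge0 (G : zmodType) H T : fingen V -> torsionwise_finite G ->
  subgroup H -> (forall i, i \in T -> sat H (e i)) ->
  exists m : {set I} -> nat, 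
    (forall S, S \subset T -> homcnt G (hull H S) (m S)) /\
    0 <= \sum_(S : {set I} | S \subset T) (-1) ^+ #|S| * (m S)%:Z.
Proof.
move=> fgV finG sH HT; have [n [_ [F eF]]] := homcnt_exists fgV finG sH.
have [tF _ _] := eF.
pose Z i := [set t | F i (e t) == 0].
exists (fun S => #|[pred i | S \subset Z i]|); split; last exact: alternating_count_ge0.
move=> S ST; have HS x : H x -> hull H S x by apply: sub_hull.
have SH x : hull H S x -> sat H x.
  apply: hull_min; [exact: subgroup_sat|exact: sub_sat|].
  by move=> i iS; apply/HT/(subsetP ST).
have := homcnt_sub sH HS SH eF; congr homcnt; apply: eq_card => i; rewrite !inE.
apply/asboolP/subsetP => [[_ f0] t tS|SZ]; first by rewrite inE f0 //; apply: mem_hull.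
split=> [x y /(sat_mono SH)/sat_sat Hx /(sat_mono SH)/sat_sat Hy|x Hx].
  exact: (tF i).1.
suff [] : sat H x /\ F i x = 0 by [].
have sS := subgroup_sat sH.
apply: (hull_min (K := fun x => sat H x /\ F i x = 0) _ _ _ Hx).
- split; first by split; [case: sS|apply: torhom0 (tF i)].
  move=> y z [Hy fy] [Hz fz]; split; first exact: sS.2.
  by rewrite (torhomB sH (tF i)) // fy fz subr0.
- by move=> y Hy; split; [apply: sub_sat|apply: (tF i).2].
- move=> t tS; split; first by apply/HT/(subsetP ST).
  by have := SZ t tS; rewrite inE => /eqP.
Qed.
End Hull.

(** * Row spans of integer matrices and transposition *)

Definition rowspan k n (M : 'M[int]_(k, n)) (x : 'rV_n) := exists u : 'rV_k, x = u *m M.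

Lemma subgroup_rowspan k n (M : 'M[int]_(k, n)) : subgroup (rowspan M).
Proof.
split; first by exists 0; rewrite mul0mx.
by move=> _ _ [u ->] [v ->]; exists (u - v); rewrite mulmxBl.
Qed.

Lemma rV_fingen n : fingen 'rV[int]_n.
Proof.
exists [seq delta_mx 0 i | i <- enum 'I_n] => x; rewrite (row_sum_delta x).
apply: subgroup_sum; first exact: subgroup_span.
move=> i _; rewrite -[x 0 i]intz scaler_int; apply: subgroupMz.
  exact: subgroup_span.
by apply/mem_in_span/map_f; rewrite mem_enum.
Qed.

Lemma rV_torsionfree n (x : 'rV[int]_n) k : (0 < k)%N -> x *+ k = 0 -> x = 0.
Proof.
move=> k0 /rowP Hx; apply/rowP => j; have := Hx j; rewrite mulmxnE !mxE => /eqP.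
by rewrite mulrn_eq0 (negbTE (lt0n_neq0 k0)) => /eqP.
Qed.

Lemma homcnt_tr (G : zmodType) k n (M : 'M[int]_(k, n)) c :
  homcnt G (rowspan M) c -> homcnt G (rowspan M^T) c.
Proof.
have [L uL [R uR [d _ ME]]] := int_Smith_normal_form M.
pose D : 'M[int]_(k, n) := \matrix_(i, j) (d`_i *+ (i == j :> nat)).
(* [P] is the rectangular identity, cutting a vector or padding it with zeros. It carries the row
   span of [D] into that of [D^T], and its transpose goes back. *)
pose P : 'M[int]_(n, k) := \matrix_(i, j) (i == j :> nat)%:R.
have DP : D *m P = P^T *m D^T.
  apply/matrixP => i j; rewrite !mxE; apply: eq_bigr => l _; rewrite !mxE.
  rewrite [(j : nat) == l]eq_sym [(l : nat) == i]eq_sym.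
  case: (eqVneq (i : nat) l) => [->|_]; last by rewrite !mul0r.
  by case: (eqVneq (l : nat) j) => [->|_]; rewrite ?mulr0 // mulr1 mul1r.
have PD : P *m D = D^T *m P^T.
  apply/matrixP => i j; rewrite !mxE; apply: eq_bigr => l _; rewrite !mxE.
  rewrite [(i : nat) == l]eq_sym [(j : nat) == l]eq_sym.
  by case: ((l : nat) == i); case: ((l : nat) == j); rewrite ?mulr0 ?mul0r ?mulr1 ?mul1r.
have DPP : D *m P *m P^T = D.
  rewrite -mulmxA; apply/matrixP => i j; rewrite mxE.
  have PPE l : (P *m P^T) l j = ((l == j) && (l < k)%N)%:R.
    rewrite mxE; have [lk|lk] := ltnP l k; last first.
      rewrite andbF big1 // => m _; rewrite !mxE.
      by have := ltn_ord m; case: eqVneq => [<-|]; rewrite ?mul0r // ltnNge lk.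
    rewrite (bigD1 (Ordinal lk)) //= big1 => [|m mn]; rewrite !mxE /= ?eqxx.
      by rewrite mul1r addr0 andbT eq_sym.
    by rewrite -val_eqE /= eq_sym in mn; rewrite (negbTE mn) mul0r.
  rewrite (bigD1 j) //= big1 => [|l lj]; rewrite PPE.
    rewrite eqxx addr0 /= mxE; case: eqVneq => [<-|_]; last by rewrite mul0r.
    by rewrite ltn_ord mulr1.
  by rewrite (negbTE lj) mulr0.
have DPP' : D^T *m P^T *m P = D^T.
  by apply: trmx_inj; rewrite !trmx_mul !trmxK PD mulmxA -DP.
have {}ME : M = L *m D *m R by [].
have sM := subgroup_rowspan M; have sM' := subgroup_rowspan M^T.
apply: (homcnt_equiv (a := fun x => x *m invmx R *m P *m L^T)
  (b := fun y => y *m invmx L^T *m P^T *m R)) => //.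
- by move=> x y; rewrite !mulmxDl subrr; case: sM'.
- move=> _ [u ->]; exists (u *m L *m P^T *m invmx R^T).
  rewrite ME !trmx_mul !mulmxA mulmxK // mulmxKV ?unitmx_tr //.
  by rewrite -(mulmxA _ D P) DP !mulmxA.
- by move=> x y; rewrite !mulmxDl subrr; case: sM.
- move=> _ [v ->]; exists (v *m R^T *m P *m invmx L).
  rewrite ME !trmx_mul !mulmxA mulmxK ?unitmx_tr // mulmxKV //.
  by rewrite -(mulmxA _ P D) PD !mulmxA.
(* On the row span the round trip is the identity by [DPP]; as a multiple of [x] lies there and the
   ambient group is torsion-free, [x] is fixed too. *)
- move=> x [q [q0 [u ux]]]; rewrite mulmxK ?unitmx_tr //.
  rewrite (_ : x - _ = 0); first by case: sM.
  apply: (rV_torsionfree q0); rewrite mulrnBl -!scaler_nat !scalemxAl scaler_nat ux ME.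
  rewrite !mulmxA mulmxK //.
  by rewrite -(mulmxA _ D P) -(mulmxA _ (D *m P)) DPP subrr.
- move=> y [q [q0 [v vy]]]; rewrite mulmxK //.
  rewrite (_ : y - _ = 0); first by case: sM'.
  apply: (rV_torsionfree q0); rewrite mulrnBl -!scaler_nat !scalemxAl scaler_nat vy ME.
  rewrite !trmx_mul !mulmxA.
  rewrite mulmxK ?unitmx_tr //.
  by rewrite -(mulmxA _ D^T P^T) -(mulmxA _ (D^T *m P^T)) DPP' subrr.
Qed.

Lemma mx_clear_denominators m n (Q : 'M[rat]_(m, n)) :
  exists (N : nat) (C : 'M[int]_(m, n)), (0 < N)%N /\ map_mx intr C = N%:R *: Q.
Proof.
pose N := (\prod_i \prod_j `|denq (Q i j)|)%N.
have N0 : (0 < N)%N.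
  by apply: prodn_gt0 => i; apply: prodn_gt0 => j; rewrite absz_gt0 denq_neq0.
exists N, (\matrix_(i, j) (numq (Q i j) * (N %/ `|denq (Q i j)|)%N%:Z)); split=> //.
apply/matrixP => i j; rewrite !mxE.
have dN : (`|denq (Q i j)| %| N)%N.
  by rewrite /N (bigD1 i) //= (bigD1 j) //= -mulnA dvdn_mulr.
rewrite -[in RHS](divq_num_den (Q i j)) -{2}(divnK dN) natrM rmorphM /=.
have -> : (`|denq (Q i j)|)%:R = (denq (Q i j))%:~R :> rat.
  by rewrite -[in RHS](absz_denq (Q i j)).
have d0 : (denq (Q i j))%:~R != 0 :> rat by rewrite intr_eq0 denq_neq0.
by rewrite -[RHS]mulrA mulrC; congr (_ * _); rewrite mulrCA divff // mulr1.
Qed.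

(** Over the rationals, the row space is cut out by the cokernel matrix. Clearing its denominators
    makes the hypothesis applicable; clearing those of the resulting coefficients puts a multiple of
    [y] into the integral row span. *)
Lemma sat_rowspan k n (M : 'M[int]_(k, n)) (y : 'rV_n) :
  (forall C : 'M[int]_n, M *m C = 0 -> y *m C = 0) -> sat (rowspan M) y.
Proof.
move=> MC; pose toQ p q : 'M[int]_(p, q) -> 'M[rat]_(p, q) := map_mx intr.
have toQ_inj p q : injective (@toQ p q).
  move=> A B /matrixP e; apply/matrixP => i j.
  by have := e i j; rewrite !mxE => /intr_inj.
have : (toQ _ _ y <= toQ _ _ M)%MS.
  rewrite submxE; have [N [C [N0 CE]]] := mx_clear_denominators (cokermx (toQ _ _ M)).
  have NQ : N%:R != 0 :> rat by rewrite pnatr_eq0 -lt0n.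
  have /(congr1 (@toQ _ _)) : y *m C = 0.
    apply/MC/toQ_inj; rewrite /toQ map_mxM CE -scalemxAr mulmx_coker scaler0.
    by rewrite map_mx0.
  rewrite /toQ map_mxM CE -scalemxAr map_mx0 => /eqP.
  by rewrite scalemx_eq0 (negbTE NQ).
move=> /submxP[w wE]; have [N [C [N0 CE]]] := mx_clear_denominators w.
exists N; split=> //; exists C; apply: toQ_inj.
by rewrite /toQ map_mxM CE -scalemxAl -/(toQ _ _ M) -wE scaler_nat raddfMn.
Qed.

Section Mask.
Variables (I : finType) (k n : nat) (r : I -> 'I_k) (M : 'M[int]_(k, n)).
Hypothesis r_inj : injective r.
Implicit Types (J F : {set I}).

(** Multiplication on the left zeroes the rows indexed by [r @: J]. Zeroing instead of removing them
    keeps the matrix format fixed. *)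
Definition mask_mx J : 'M[int]_k := diag_mx (\row_l (l \notin r @: J)%:R).

Lemma delta_mask J i : i \in J -> delta_mx 0 (r i) *m mask_mx J = 0 :> 'rV_k.
Proof.
move=> iJ; apply/rowP => l; rewrite mul_mx_diag !mxE.
by have [->|] := eqVneq l (r i); rewrite ?mul0r // imset_f // mulr0.
Qed.

Lemma sub_mask J (y : 'rV_k) :
  y - y *m mask_mx J = \sum_(i in J) delta_mx 0 (r i) *~ y 0 (r i).
Proof.
apply/rowP => l; rewrite mul_mx_diag !mxE summxE.
have E i : (delta_mx 0 (r i) *~ y 0 (r i) : 'rV_k) 0 l = y 0 l *+ (l == r i).
  rewrite -scaler_int !mxE /= intz.
  by have [->|] := eqVneq l (r i); rewrite ?mulr1 ?mulr0.
under eq_bigr do rewrite E.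
have [/imsetP[i iJ ->]|lJ] := boolP (l \in r @: J).
  rewrite mulr0 subr0 (bigD1 i) //= eqxx big1 ?addr0 // => j /andP[_ ji].
  by rewrite (inj_eq r_inj) eq_sym (negbTE ji).
rewrite mulr1 subrr big1 // => i iJ; case: eqVneq => // lE.
by rewrite lE imset_f in lJ.
Qed.

(* Masked rows of M are deleted columns of the transpose; as deletion and
   contraction are dual, the transposed side adds the basis vectors instead. *)
Lemma homcnt_mask (G : zmodType) J c :
  homcnt G (hull (fun i => delta_mx 0 (r i)) (rowspan M^T) J) c ->
  homcnt G (rowspan (mask_mx J *m M)) c.
Proof.
set e := fun i => _; have sT := subgroup_rowspan M^T.
have sL := subgroup_hull e J sT; have sK := subgroup_rowspan (mask_mx J *m M)^T.
move=> cnt; rewrite -[mask_mx J *m M]trmxK; apply: homcnt_tr; move: cnt.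
have trE : (mask_mx J *m M)^T = M^T *m mask_mx J by rewrite trmx_mul tr_diag_mx.
have mask2 : mask_mx J *m mask_mx J = mask_mx J.
  apply/matrixP => i l; rewrite mul_diag_mx !mxE.
  by case: (i \in _); rewrite ?mul0r ?mul0rn // mul1r.
have Ly y : hull e (rowspan M^T) J (y - y *m mask_mx J).
  rewrite sub_mask; apply: (subgroup_sum _ sL) => i iJ.
  by apply: subgroupMz => //; apply: mem_hull.
apply: (homcnt_equiv (a := fun y => y *m mask_mx J) (b := id)) => //.
- by move=> x y; rewrite mulmxDl subrr; case: sK.
- move=> x; apply: (hull_min (K := fun y => rowspan (mask_mx J *m M)^T (y *m mask_mx J))).
  + split; first by rewrite mul0mx; case: sK.
    by move=> y z Hy Hz; rewrite mulmxBl; apply: sK.2.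
  + by move=> _ [u ->]; exists u; rewrite trE mulmxA.
  + by move=> i iJ; rewrite delta_mask //; case: sK.
- by move=> x y; rewrite subrr; case: sL.
- move=> _ [u ->]; rewrite trE mulmxA -[X in hull _ _ _ X](subKr (u *m M^T)).
  by apply: sL.2 => //; apply: sub_hull; exists u.
- move=> y [q [q0 [u uy]]]; rewrite (_ : y - _ = 0); first by case: sK.
  apply: (rV_torsionfree q0); rewrite mulrnBl -!scaler_nat !scalemxAl scaler_nat uy trE.
  by rewrite -!mulmxA mask2 subrr.
Qed.

(** By [sat_rowspan] some [C] is annihilated by all rows of [M] except row [r f]. A column of [C] on
    which that row is nonzero combines the columns of [M] to a nonzero multiple of the basis
    vector. *)
Lemma sat_delta f : ~ sat (rowspan (mask_mx [set f] *m M)) (row (r f) M) ->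
  sat (rowspan M^T) (delta_mx 0 (r f)).
Proof.
move=> /(contra_not (@sat_rowspan _ _ _ _))/existsNP[C /not_implyP[MC /eqP rC]].
have [j dj] : exists j, (row (r f) M *m C) 0 j != 0.
  by apply/existsP; apply: contraNT rC => /existsPn H; apply/eqP/rowP => j;
     rewrite [RHS]mxE; apply/eqP/negPn/H.
apply: (satMz (subgroup_rowspan _) dj); exists (row j C^T).
rewrite -(row_mul j C^T) -trmx_mul -scaler_int intz; apply/rowP => l; rewrite !mxE /=.
have [->|lf] := eqVneq l (r f); first by rewrite mulr1; apply: eq_bigr => i _; rewrite !mxE.
rewrite mulr0; have /matrixP/(_ l j) := MC.
rewrite -mulmxA mul_diag_mx !mxE imset_set1 inE lf mul1r => MC0.
by symmetry; apply: etrans MC0; apply: eq_bigr.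
Qed.

(** On the transposed side the rows in question become torsion basis vectors, to which
    [alternating_hull_ge0] applies. *)
Lemma alternating_mask_ge0 (G : zmodType) F : torsionwise_finite G ->
  (forall f, f \in F -> ~ sat (rowspan (mask_mx [set f] *m M)) (row (r f) M)) ->
  exists m : {set I} -> nat,
    (forall J, J \subset F -> homcnt G (rowspan (mask_mx J *m M)) (m J)) /\
    0 <= \sum_(J : {set I} | J \subset F) (-1) ^+ #|J| * (m J)%:Z.
Proof.
move=> finG HF; have [] := @alternating_hull_ge0 _ I (fun i => delta_mx 0 (r i)) G
  (rowspan M^T) F (rV_fingen k) finG (subgroup_rowspan _).
  by move=> i iF; apply/sat_delta/HF.
by move=> m [mE m0]; exists m; split=> // J /mE; apply: homcnt_mask.
Qed.
End Mask.

(** A surjection [p] identifies [V/K] with the quotient of [W] by the preimage of [K]; the section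
    [s] need not be additive. *)
Lemma homcnt_pullback (V W G : zmodType) (p : {additive W -> V}) (s : V -> W)
    (K : V -> Prop) n : subgroup K -> cancel s p ->
  homcnt G (fun x => K (p x)) n -> homcnt G K n.
Proof.
move=> sK sp; have [K0 KB] := sK.
apply: (homcnt_equiv (a := p) (b := s)) => //=.
- by split=> [|x y Hx Hy]; rewrite ?raddf0 // raddfB; apply: KB.
- by move=> x y; rewrite raddfD subrr.
- by move=> x y; rewrite raddfB raddfD !sp subrr.
- by move=> y; rewrite sp.
- by move=> x _; rewrite raddfB sp subrr.
- by move=> y _; rewrite sp subrr.
Qed.

(** The map from a free group onto the span of [s], used to present [V]. *)
Definition row_comb (V : zmodType) (s : seq V) (x : 'rV[int]_(size s)) : V :=
  \sum_(i < size s) s`_i *~ x 0 i.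

Lemma row_comb_is_zmod_morphism (V : zmodType) (s : seq V) :
  zmod_morphism (@row_comb V s).
Proof.
by move=> x y; rewrite -sumrB; apply: eq_bigr => i _; rewrite !mxE mulrzBr.
Qed.

HB.instance Definition _ (V : zmodType) (s : seq V) :=
  GRing.isZmodMorphism.Build _ _ (@row_comb V s) (@row_comb_is_zmod_morphism V s).

Lemma in_span_rowspan n (t : seq 'rV[int]_n) x :
  in_span t x <-> rowspan (\matrix_(i < size t) t`_i) x.
Proof.
split=> [[c ->]|[u ->]].
  exists (\row_i c`_i); rewrite mulmx_sum_row; apply: eq_bigr => i _.
  by rewrite mxE rowK -scaler_int intz.
rewrite mulmx_sum_row; apply: subgroup_sum; first exact: subgroup_span.
move=> i _; rewrite rowK -[u 0 i]intz scaler_int; apply: subgroupMz.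
  exact: subgroup_span.
exact/mem_in_span/mem_nth.
Qed.

(** Along a presentation of [V], the preimage of [H] is spanned by the rows of [B], and lifts of the
    [a f] are appended below as [A F]. Dropping [J] from [F] then amounts to masking rows. *)
Lemma alternating_coloop_ge0 (V G : zmodType) (H : V -> Prop) N (a : 'I_N -> V)
    (F : {set 'I_N}) : fingen V -> torsionwise_finite G -> subgroup H ->
  (forall f, f \in F -> ~ sat (hull a H (F :\ f)) (a f)) ->
  exists m : {set 'I_N} -> nat,
    (forall J : {set 'I_N}, J \subset F -> homcnt G (hull a H (F :\: J)) (m J)) /\
    0 <= \sum_(J : {set 'I_N} | J \subset F) (-1) ^+ #|J| * (m J)%:Z.
Proof.
move=> [gens genV] finG sH HF; pose p : {additive 'rV[int]_(size gens) -> V} := @row_comb V gens.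
have /choice[s sK] v : exists x, p x = v.
  have [c ->] := genV v; exists (\row_i c`_i).
  by apply: eq_bigr => i _; rewrite mxE.
have [t tE] : exists t, forall x, H (p x) <-> in_span t x.
  have [gV' gVE] := rV_fingen (size gens).
  apply: (subgroup_fg (s := gV')); last by move=> x _; apply: gVE.
  by case: sH => H0 HB; split=> [|x y Hx Hy]; rewrite ?raddf0 // raddfB; apply: HB.
pose B := \matrix_(i < size t) t`_i.
pose A (S : {set 'I_N}) := \matrix_(i < N) (if i \in S then s (a i) else 0).
pose r := @rshift (size t) N.
have r_inj : injective r by exact: rshift_inj.
pose M := col_mx B (A F).
have maskE J : mask_mx r J *m M = col_mx B (A (F :\: J)).
  apply/row_matrixP => i; rewrite row_mul row_diag_mx -scalemxAl mxE -rowE.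
  have [l ->|l ->] := split_ordP i.
    rewrite !rowKu (_ : _ \notin _ = true) ?scale1r //.
    by apply/negP => /imsetP[j _ /eqP]; rewrite eq_lrshift.
  rewrite !rowKd !rowK (mem_imset _ _ r_inj) inE.
  by case: (l \in J); case: (l \in F); rewrite ?scale0r ?scale1r.
have hullE S x : rowspan (col_mx B (A S)) x <-> hull a H S (p x).
  have sumE (c : 'I_N -> int) : (\row_i c i) *m A S = \sum_(i in S) s (a i) *~ c i.
    rewrite mulmx_sum_row [RHS]big_mkcond; apply: eq_bigr => i _.
    by rewrite mxE rowK; case: ifP; rewrite ?scaler0 // -scaler_int intz.
  have psumE (c : 'I_N -> int) :
      p (\sum_(i in S) s (a i) *~ c i) = \sum_(i in S) a i *~ c i.
    by rewrite raddf_sum; apply: eq_bigr => i _; rewrite raddfMz sK.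
  split=> [[u ->]|[c]].
    rewrite -[u]hsubmxK mul_row_col; exists (fun i => rsubmx u 0 i).
    rewrite -psumE -sumE -raddfB (_ : \row_i _ = rsubmx u) ?addrK.
      by apply/tE/in_span_rowspan; exists (lsubmx u).
    by apply/rowP => i; rewrite mxE.
  rewrite -psumE -raddfB => /tE/in_span_rowspan[u uE].
  exists (row_mx u (\row_i c i)).
  by rewrite mul_row_col -uE sumE subrK.
have [] := @alternating_mask_ge0 _ _ _ _ M r_inj G F finG.
  move=> f fF [q [q0]]; rewrite maskE => /hullE Hq; apply: (HF f fF).
  exists q; split=> //; move: Hq; rewrite raddfMn rowKd rowK fF sK.
  by congr (hull _ _ _ _); apply/setP => i; rewrite !inE andbC.
move=> m [mE m0]; exists m; split=> // J JF.
apply: (homcnt_pullback (p := p) _ sK); first exact: subgroup_hull.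
have := mE J JF; rewrite maskE; congr homcnt; apply/funext => x; apply/propext.
exact: hullE.
Qed.

(** * Deletion-contraction *)

Definition nonneg_coefs (p : {poly {poly int}}) := forall i j, 0 <= p`_j`_i.

Lemma nonneg_coefs_sum (I : Type) (r : seq I) (P : pred I) (F : I -> {poly {poly int}}) :
  (forall i, P i -> nonneg_coefs (F i)) -> nonneg_coefs (\sum_(i <- r | P i) F i).
Proof.
by move=> HF i j; rewrite !coef_sum; apply: sumr_ge0 => k Pk; apply: HF.
Qed.

Lemma nonneg_coefs_monomial (c : int) a b : 0 <= c ->
  nonneg_coefs (c%:P%:P * ('X^a)%:P * 'X^b).
Proof.
move=> c0 i j; rewrite -polyCM coefCM coefXn.
case: (j == b); rewrite ?mulr1 ?mulr0 ?coef0 // coefCM coefXn.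
by case: (i == a); rewrite ?mulr1 ?mulr0.
Qed.

(** Expanding [(x - 1) ^+ #|J|] over subsets and exchanging the sums turns powers of [x - 1] into
    powers of [x], with alternating sums as coefficients. *)
Lemma sum_subsets_shift (A : comRingType) (I : finType) (F : {set I})
    (g : {set I} -> A) (x : A) :
  \sum_(J : {set I} | J \subset F) g J * (x - 1) ^+ #|J| =
  \sum_(J : {set I} | J \subset F)
    x ^+ #|J| * \sum_(K : {set I} | K \subset F :\: J) (-1) ^+ #|K| * g (J :|: K).
Proof.
under eq_bigr do rewrite exprD_subsets mulr_sumr.
rewrite (exchange_big_dep (fun J : {set I} => J \subset F)) /=; last first.
  by move=> J K JF KJ; apply: subset_trans JF.
apply: eq_bigr => J JF; rewrite mulr_sumr.
rewrite (reindex_onto (fun K => J :|: K) (fun K => K :\: J)) /=; last first.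
  by move=> K /andP[_ JK]; rewrite -[RHS](setID K J) (setIidPr JK).
have DK K : (J :|: K) :\: J = K :\: J by rewrite setDUl setDv set0U.
apply: eq_big => [K|K /andP[_ /eqP]]; rewrite DK; last first.
  by move=> ->; rewrite mulrC -mulrA.
rewrite subUset JF subsetUl andbT subsetD; apply: andb_id2l => _.
by apply/eqP/idP => /setDidPl.
Qed.

(** A set [S] of the interval corresponds to the pair of [F :\: S] and [S :&: T]. The missing part
    of [F] is recorded because its size will be the exponent of [x - 1]. *)
Lemma sum_molecule (A : zmodType) (I : finType) (R F T : {set I}) (g : {set I} -> A) :
  [disjoint R & F] -> [disjoint R & T] -> [disjoint F & T] ->
  \sum_(S : {set I} | (R \subset S) && (S \subset R :|: F :|: T)) g S =
  \sum_(J : {set I} | J \subset F) \sum_(K : {set I} | K \subset T)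
    g (R :|: (F :\: J) :|: K).
Proof.
move=> dRF dRT dFT.
have dis a : [&& ~~ ((a \in R) && (a \in F)), ~~ ((a \in R) && (a \in T))
    & ~~ ((a \in F) && (a \in T))].
  apply/and3P; split; apply/negP => /andP[].
  - by move=> /(disjointFr dRF) ->.
  - by move=> /(disjointFr dRT) ->.
  - by move=> /(disjointFr dFT) ->.
have subP (B C : {set I}) a : B \subset C -> (a \in B) ==> (a \in C).
  by move=> /subsetP BC; apply/implyP/BC.
rewrite pair_big_dep /=.
rewrite (reindex_onto (fun JK : {set I} * {set I} => R :|: (F :\: JK.1) :|: JK.2)
  (fun S => (F :\: S, S :&: T))) /=; last first.
  move=> S /andP[RS SE]; apply/setP => a.
  move: (dis a) (subP _ _ a RS) (subP _ _ a SE); rewrite !inE.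
  by case: (a \in R); case: (a \in F); case: (a \in T); case: (a \in S).
apply: eq_bigl => -[J K] /=; apply/andP/andP => [[_ /eqP[<- <-]]|[JF KT]].
  by rewrite subsetDl subsetIr.
split; first by rewrite -setUA subsetUl -!setUA setUS // setUSS // subsetDl.
apply/eqP; congr (_, _); apply/setP => a;
  move: (dis a) (subP _ _ a JF) (subP _ _ a KT); rewrite !inE;
  by case: (a \in R); case: (a \in F); case: (a \in T); case: (a \in J);
    case: (a \in K).
Qed.

(** * Sums over intervals of subsets, for abstract rank and multiplicity *)

Section Interval.
Variables (I : finType) (c : {set I} -> int) (r : {set I} -> nat).
Implicit Types (R E F S T J : {set I}).

Hypothesis r_add : forall a S, r (a |: S) = r S \/ r (a |: S) = (r S).+1.
Hypothesis r_loop : forall a S T, S \subset T -> r (a |: S) = r S -> r (a |: T) = r T.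
(** The arithmetic input on the multiplicity: [T] consists of loops modulo [R], and [F] of coloops
    of the whole union. *)
Hypothesis c_molecule : forall R F T,
  [disjoint R & F] -> [disjoint R & T] -> [disjoint F & T] ->
  (forall t, t \in T -> r (t |: R) = r R) ->
  (forall f, f \in F -> r ((R :|: F :|: T) :\ f) <> r (R :|: F :|: T)) ->
  0 <= \sum_(J : {set I} | J \subset F) \sum_(T' : {set I} | T' \subset T)
         (-1) ^+ #|J| * (-1) ^+ #|T'| * c (R :|: (F :\: J) :|: T').

Definition interval_poly R E : {poly {poly int}} :=
  \sum_(S : {set I} | (R \subset S) && (S \subset E))
    (c S)%:P%:P * (('X - 1) ^+ (r E - r S))%:P * ('X - 1) ^+ (#|S| - r S).

(** Sets avoiding [a] give the deletion, sets containing [a] the contraction; the exponents agree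
    because deleting [a] preserves the rank of [E]. *)
Lemma interval_poly_split R E a : a \in E -> a \notin R -> r (E :\ a) = r E ->
  interval_poly R E = interval_poly R (E :\ a) + interval_poly (a |: R) E.
Proof.
move=> aE aR rE; rewrite /interval_poly (bigID (fun S => a \in S)) /= addrC rE.
congr (_ + _); apply: eq_bigl => S.
  by rewrite subsetD1 andbA.
by rewrite subUset sub1set; case: (a \in S); rewrite ?andbT ?andbF.
Qed.

(** Here [E] is [R] plus coloops [F] and loops [T], so the exponents count the absent coloops and
    the present loops. Passing to powers of the variables, the coefficients become the sums of
    [c_molecule] for smaller molecules. *)
Lemma molecule_nonneg R E : R \subset E -> r R = #|R| ->
  (forall a, a \in E -> a \notin R -> r (a |: R) = r R \/ r (E :\ a) <> r E) ->
  nonneg_coefs (interval_poly R E).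
Proof.
move=> RE rR HE.
pose F := [set a in E :\: R | r (a |: R) != r R].
pose T := [set a in E :\: R | r (a |: R) == r R].
have dRF : [disjoint R & F].
  by rewrite disjoint_sym disjoint_subset; apply/subsetP => a; rewrite !inE => /andP[/andP[]].
have dRT : [disjoint R & T].
  by rewrite disjoint_sym disjoint_subset; apply/subsetP => a; rewrite !inE => /andP[/andP[]].
have dFT : [disjoint F & T].
  by rewrite disjoint_subset; apply/subsetP => a; rewrite !inE => /andP[_ /negbTE->]; rewrite andbF.
have EE : E = R :|: F :|: T.
  apply/setP => a; rewrite !inE; have := subsetP RE a.
  by case: (a \in R) => [->//|_]; case: (a \in E); case: eqVneq.
have FR f : f \in F -> r (E :\ f) <> r E.
  rewrite !inE => /andP[/andP[fR fE] /eqP rf].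
  by case: (HE f fE fR).
have TR t : t \in T -> r (t |: R) = r R by rewrite !inE => /andP[_ /eqP].
have coloop S f : f \in F -> S \subset E -> f \notin S -> r (f |: S) = (r S).+1.
  move=> fF SE fS; case: (r_add f S) => // rf; case: (FR f fF).
  have fE : f \in E by move: fF; rewrite !inE => /andP[/andP[]].
  rewrite -[in RHS](setD1K fE); apply: esym; apply: r_loop rf.
  by rewrite subsetD1 SE.
(* Elements outside [R] are removed one at a time: a coloop lowers the rank by one, a loop leaves it
   unchanged. *)
have rank S : R \subset S -> S \subset E -> r S = (#|R| + #|S :&: F|)%N.
  have [n] := ubnP #|S :\: R|; elim: n S => // n IH S; rewrite ltnS => le RS SE.
  have [/eqP|[a]] := set_0Vmem (S :\: R).
    rewrite setD_eq0 => SR; have -> : S = R by apply/eqP; rewrite eqEsubset SR.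
    by rewrite disjoint_setI0 // cards0 addn0.
  rewrite inE => /andP[aR aS].
  have aSR : a \in S :\: R by rewrite inE aR.
  have RS' : R \subset S :\ a by rewrite subsetD1 RS.
  have SE' : S :\ a \subset E by apply: subset_trans SE; apply: subD1set.
  have rS' : r (S :\ a) = (#|R| + #|(S :\ a) :&: F|)%N.
    by apply: IH => //; rewrite setDDl setUC -setDDl; move: le; rewrite (cardsD1 a) aSR.
  have aS' : a \notin S :\ a by rewrite !inE eqxx.
  rewrite -(setD1K aS) setIUl; have : a \in R :|: F :|: T by rewrite -EE (subsetP SE).
  rewrite !in_setU (negbTE aR) /= => /orP[aF|aT].
    have -> : [set a] :&: F = [set a] by apply/setIidPl; rewrite sub1set.
    by rewrite coloop // rS' cardsU1 in_setI (negbTE aS') /= add1n addnS.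
  have aF : a \notin F by rewrite (disjointFl dFT aT).
  rewrite (r_loop RS' (TR a aT)) rS' (_ : [set a] :&: F = set0) ?set0U //.
  by apply/eqP; rewrite setI_eq0 disjoints1.
have FE : F \subset E by rewrite EE -setUA setUCA subsetUl.
have TE : T \subset E by rewrite EE subsetUr.
pose U (J K : {set I}) := R :|: (F :\: J) :|: K.
have -> : interval_poly R E =
  \sum_(J : {set I} | J \subset F) \sum_(K : {set I} | K \subset T)
    (c (U J K))%:P%:P * (('X - 1) ^+ #|J|)%:P * ('X - 1) ^+ #|K|.
  have rE : r E = (#|R| + #|F|)%N by rewrite rank // (setIidPr FE).
  rewrite /interval_poly {1}EE sum_molecule //.
  apply: eq_bigr => J JF; apply: eq_bigr => K KT; rewrite -/(U J K).
  have RU : R \subset U J K by rewrite /U -setUA subsetUl.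
  have UE : U J K \subset E by rewrite /U EE -!setUA setUS // setUSS // subsetDl.
  have UF : U J K :&: F = F :\: J.
    rewrite /U !setIUl (disjoint_setI0 dRF) set0U (setIidPl (subsetDl _ _)).
    rewrite (_ : K :&: F = set0) ?setU0 //; apply/eqP; rewrite setI_eq0.
    by rewrite disjoint_sym; apply: disjointWr dFT.
  have cU : #|U J K| = (#|R| + #|F :\: J| + #|K|)%N.
    have RFJ : R :&: (F :\: J) = set0.
      exact: disjoint_setI0 (disjointWr (subsetDl F J) dRF).
    have RFJK : (R :|: (F :\: J)) :&: K = set0.
      rewrite setIUl (disjoint_setI0 (disjointWr KT dRT)) set0U.
      exact: disjoint_setI0 (disjointW (subsetDl F J) KT dFT).
    by rewrite /U cardsU RFJK cards0 subn0 cardsU RFJ cards0 subn0.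
  have cF : #|F| = (#|J| + #|F :\: J|)%N by rewrite -(cardsID J F) (setIidPr JF).
  rewrite rE (rank _ RU UE) UF cU cF; congr (_ * (_ ^+ _)%:P * _ ^+ _); lia.
(* The shift is applied first in the outer variable over [T], then in the inner variable over
   [F]. *)
have -> : \sum_(J : {set I} | J \subset F) \sum_(K : {set I} | K \subset T)
    (c (U J K))%:P%:P * (('X - 1) ^+ #|J|)%:P * ('X - 1) ^+ #|K| =
  \sum_(K : {set I} | K \subset T) \sum_(J : {set I} | J \subset F)
    (\sum_(J' : {set I} | J' \subset F :\: J) \sum_(K' : {set I} | K' \subset T :\: K)
         (-1) ^+ #|J'| * (-1) ^+ #|K'| * c (U (J :|: J') (K :|: K')))%:P%:P *
    ('X^#|J|)%:P * 'X^#|K| :> {poly {poly int}}.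
  under eq_bigr do rewrite sum_subsets_shift.
  rewrite exchange_big /=; apply: eq_bigr => K _.
  transitivity (\sum_(J : {set I} | J \subset F)
    ('X^#|K| * \sum_(K' : {set I} | K' \subset T :\: K)
       (-1) ^+ #|K'| * (c (U J (K :|: K')))%:P%:P) * ('X%:P - 1) ^+ #|J|
     : {poly {poly int}}).
    apply: eq_bigr => J _; rewrite -mulrA; congr (_ * _); rewrite mulr_suml.
    by apply: eq_bigr => K' _; rewrite rmorphXn rmorphB /= -!mulrA.
  rewrite sum_subsets_shift; apply: eq_bigr => J _.
  rewrite !raddf_sum !mulr_suml mulr_sumr; apply: eq_bigr => J' _.
  rewrite !raddf_sum !mulr_suml !mulr_sumr; apply: eq_bigr => K' _.
  rewrite /= !rmorphM /= !rmorphXn /= !rmorphN1; ring.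
apply: nonneg_coefs_sum => K KT; apply: nonneg_coefs_sum => J JF.
apply: nonneg_coefs_monomial.
(* The coefficient at [J], [K] belongs to the molecule with base [R :|: K], coloops [F :\: J] and
   loops [T :\: K]. *)
have UE (J' K' : {set I}) :
    U (J :|: J') (K :|: K') = R :|: K :|: ((F :\: J) :\: J') :|: K'.
  by rewrite /U setDDl -!setUA; congr (_ :|: _); rewrite setUCA.
under eq_bigr do under eq_bigr do rewrite UE.
apply: c_molecule.
- rewrite -setI_eq0 setIUl (disjoint_setI0 (disjointWr (subsetDl F J) dRF)) set0U.
  by rewrite setIC setI_eq0; apply: disjointW dFT; rewrite ?subsetDl.
- rewrite -setI_eq0 setIUl (disjoint_setI0 (disjointWr (subsetDl T K) dRT)) set0U.
  by rewrite setIDA setD_eq0 subsetIl.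
- by apply: disjointW dFT; apply: subsetDl.
- by move=> t /setDP[tT _]; apply: r_loop (TR t tT); apply: subsetUl.
- move=> f /setDP[fF fJ]; set E' := _ :|: _ => rf; case: (FR f fF).
  have E'E : E' \subset E.
    rewrite EE /E' !subUset -!setUA subsetUl (subset_trans KT) ?setUA ?subsetUr //=.
    by rewrite (subset_trans (subsetDl _ _)) -?EE // (subset_trans (subsetDl _ _)).
  have fE' : f \in E' by rewrite /E' !in_setU in_setD fF fJ orbT.
  rewrite -[in RHS](setD1K (subsetP E'E f fE')); apply: esym.
  by apply: (@r_loop f (E' :\ f)); [apply: setSD | rewrite setD1K].
Qed.

(** Induction on the size of [E :\: R]: deletion and contraction both shrink it, and contracting a
    non-loop keeps [R] independent. When no element can be split off, a molecule remains. *)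
Lemma interval_nonneg R E : R \subset E -> r R = #|R| ->
  nonneg_coefs (interval_poly R E).
Proof.
have [n] := ubnP #|E :\: R|; elim: n R E => // n IH R E; rewrite ltnS => le RE rR.
have [[a [aE [aR [ra rEa]]]]|H] := pselect (exists a, a \in E /\ a \notin R /\
    r (a |: R) <> r R /\ r (E :\ a) = r E).
  rewrite (interval_poly_split aE aR rEa) => i j; rewrite !coefD.
  have aER : a \in E :\: R by rewrite inE aE aR.
  have lt : (#|(E :\: R) :\ a| < n)%N by move: le; rewrite (cardsD1 a) aER.
  apply: addr_ge0; apply: IH.
  - by move: lt; rewrite !setDDl setUC.
  - by rewrite subsetD1 RE aR.
  - by [].
  - by move: lt; rewrite !setDDl setUC.
  - by rewrite subUset sub1set aE.
  - by rewrite cardsU1 aR -rR; case: (r_add a R).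
apply: molecule_nonneg => // a aE aR.
have [ra|ra] := pselect (r (a |: R) = r R); [by left|right=> rEa].
by apply: H; exists a.
Qed.
End Interval.

(** * Multiplicities of sublists *)

(** If [x] is torsion modulo [H], a nonzero coefficient [c i] in its expression would make [e i]
    torsion modulo [H] and the other [e j]. *)
Lemma sat_hull_indep (V : zmodType) (I : finType) (e : I -> V) (H : V -> Prop)
    (F : {set I}) x : subgroup H ->
  (forall f, f \in F -> ~ sat (hull e H (F :\ f)) (e f)) ->
  sat H x -> hull e H F x -> H x.
Proof.
move=> sH indF Hx [c Hc].
suff c0 i : i \in F -> c i = 0.
  by move: Hc; rewrite big1 ?subr0 // => i /c0 ->; rewrite mulr0z.
move=> iF; apply: contra_notP (indF i iF) => /eqP ci0.
have sK := subgroup_hull e (F :\ i) sH; have sS := subgroup_sat sK.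
have HS y : sat H y -> sat (hull e H (F :\ i)) y by apply: sat_mono; apply: sub_hull.
apply/sat_sat/(satMz sS ci0).
have -> : e i *~ c i =
    x - (x - \sum_(i in F) e i *~ c i) - \sum_(j in F :\ i) e j *~ c j.
  by rewrite subKr (big_setD1 i) //= addrK.
apply: sS.2.
  by apply: sS.2; [apply: HS | apply/HS/sub_sat].
apply: sub_sat; apply: (subgroup_sum _ sK) => j jF.
by apply: subgroupMz => //; apply: mem_hull.
Qed.

(** By [homcnt_mul], [k] is [h * q] and [k'] is [h' * q] with the same [q], since [K + sat H] and
    [K' + sat H'] coincide. *)
Lemma homcnt_modular (V G : zmodType) (H K H' K' : V -> Prop) h k h' k' :
  fingen V -> torsionwise_finite G -> divisible G ->
  subgroup H -> subgroup K -> subgroup H' -> subgroup K' ->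
  (forall x, H x -> K x) -> (forall x, H' x -> K' x) ->
  (forall x, H x -> H' x) -> (forall x, H' x -> sat H x) ->
  (forall x, K x -> K' x) -> (forall x, K' x -> addg K (sat H) x) ->
  (forall x, sat H x -> K x -> H x) -> (forall x, sat H' x -> K' x -> H' x) ->
  homcnt G H h -> homcnt G K k -> homcnt G H' h' -> homcnt G K' k' ->
  (k' * h = k * h')%N.
Proof.
move=> fgV finG divG sH sK sH' sK' HK HK' HH' H'H KK' K'K inj inj' cH cK cH' cK'.
have satE : sat H' = sat H.
  apply/funext => x; apply/propext; split; last exact: sat_mono.
  by move=> /(sat_mono H'H)/sat_sat.
have sS := subgroup_sat sH; have sQ := subgroup_addg sK sS.
have sQ' := subgroup_addg sK' sS.
have addE : addg K' (sat H) = addg K (sat H).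
  apply/funext => x; apply/propext; split; apply: addg_min => // y.
  - by apply: addgr.
  - by move=> Ky; apply: addgl => //; apply: KK'.
  - by apply: addgr.
have [q [_ cQ]] := homcnt_exists fgV finG sQ.
have -> := homcnt_uniq cK (homcnt_mul fgV divG sH sK HK inj cH cQ).
have cQ' : homcnt G (addg K' (sat H')) q by rewrite satE addE.
have -> := homcnt_uniq cK' (homcnt_mul fgV divG sH' sK' HK' inj' cH' cQ').
by rewrite mulnC mulnA mulnAC.
Qed.

(** * The multiplicity and rank of sublists meet the abstract conditions *)

Section Tutte.
Variables (V G : zmodType) (A : seq V).
Hypotheses (fgV : fingen V) (finG : torsionwise_finite G) (divG : divisible G).
Local Notation I := 'I_(size A).
Implicit Types (R F S T : {set I}).

Let a (i : I) : V := A`_i.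
Let H S := in_span (@sublist V A S).
Let c S := mcount G (@sublist V A S).
Let r S := zrank (@sublist V A S).

Let sH S : subgroup (H S). Proof. exact: subgroup_span. Qed.

Lemma mem_sublist S x : x \in @sublist V A S <-> exists2 i, i \in S & x = a i.
Proof.
split=> [/mapP[i]|[i iS ->]]; first by rewrite mem_enum => iS ->; exists i.
by apply/mapP; exists i; rewrite ?mem_enum.
Qed.

Lemma span_sublist_mem S i : i \in S -> H S (a i).
Proof. by move=> iS; apply/mem_in_span/mem_sublist; exists i. Qed.

Lemma span_sublist_min S (K : V -> Prop) : subgroup K ->
  (forall i, i \in S -> K (a i)) -> forall x, H S x -> K x.
Proof.
by move=> sK SK; apply: span_min => // x /mem_sublist[i iS ->]; apply: SK.
Qed.

Lemma span_sublist_mono S T x : S \subset T -> H S x -> H T x.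
Proof.
move=> /subsetP ST; apply: span_sublist_min => // i iS.
by apply: span_sublist_mem; apply: ST.
Qed.

Lemma hull_sublist R S : hull a (H R) S = H (R :|: S).
Proof.
apply/funext => x; apply/propext; split.
  apply: hull_min => // [y|i iS]; first by apply: span_sublist_mono; apply: subsetUl.
  by apply: span_sublist_mem; rewrite inE iS orbT.
have sK := subgroup_hull a S (sH R).
apply: span_sublist_min => // i /setUP[iR|iS]; last exact: mem_hull.
by apply: sub_hull; apply: span_sublist_mem.
Qed.

Lemma zrank_add i S : r (i |: S) = (r S + ~~ `[< sat (H S) (a i) >])%N.
Proof.
apply: zrank_uniq; apply: (rank_is_add (sH S) (zrankP _)) => x.
rewrite -[in_span _]/(H (i |: S)) setUC -hull_sublist; split=> [[d]|[d [y [Hy ->]]]].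
  rewrite big_set1 => Hd; exists (d i), (x - a i *~ d i).
  by rewrite [RHS]addrC subrK.
by exists (fun=> d); rewrite big_set1 addrC addKr.
Qed.

Lemma zrank_loopE i S : r (i |: S) = r S <-> sat (H S) (a i).
Proof.
rewrite zrank_add; split=> [|/asboolP ->]; last by rewrite addn0.
by case: asboolP => // _ /eqP; rewrite addn1 eqn_leq ltnn.
Qed.

(** The epsilon in [mcount] selects a correct count because one exists. *)
Lemma mcountP S : homcnt G (H S) (c S).
Proof.
have [n [_ Hn]] := homcnt_exists fgV finG (sH S).
exact: (ClassicalEpsilon.epsilon_spec (inhabits 0%N) (hom_count_is G _) (ex_intro _ n Hn)).
Qed.

Lemma mcount_gt0 S : (0 < c S)%N.
Proof.
have [n [n0 Hn]] := homcnt_exists fgV finG (sH S).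
by rewrite (homcnt_uniq (mcountP S) Hn).
Qed.

(** After multiplication by the positive [c R], modularity splits the double sum into a sum over
    coloops and a sum over loops, both non-negative. *)
Lemma mcount_molecule R F T :
  [disjoint R & F] -> [disjoint R & T] -> [disjoint F & T] ->
  (forall t, t \in T -> r (t |: R) = r R) ->
  (forall f, f \in F -> r ((R :|: F :|: T) :\ f) <> r (R :|: F :|: T)) ->
  0 <= \sum_(J : {set I} | J \subset F) \sum_(K : {set I} | K \subset T)
         (-1) ^+ #|J| * (-1) ^+ #|K| * (c (R :|: (F :\: J) :|: K))%:Z.
Proof.
move=> dRF dRT dFT loop coloop.
have satT t : t \in T -> sat (H R) (a t) by move=> /loop/zrank_loopE.
have indF S f : f \in F -> S \subset R :|: F :|: T -> f \notin S -> ~ sat (H S) (a f).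
  move=> fF SE fS sf; apply: (coloop f fF).
  have fE : f \in R :|: F :|: T by rewrite !inE fF orbT.
  rewrite -[in RHS](setD1K fE); apply: esym; apply/zrank_loopE.
  by apply: sat_mono sf => x; apply: span_sublist_mono; rewrite subsetD1 SE.
(* Coloops are independent modulo [R :|: T'], so adjoining them puts no new torsion elements into
   the span. *)
have inj (F' T' : {set I}) x : F' \subset F -> T' \subset T ->
    sat (H (R :|: T')) x -> H (R :|: F' :|: T') x -> H (R :|: T') x.
  move=> F'F T'T; rewrite setUAC -(hull_sublist _ F').
  apply: sat_hull_indep => // f fF'.
  have fF := subsetP F'F f fF'.
  rewrite hull_sublist; apply: indF => //.
    rewrite setUAC; do 2![apply: setUSS => //].
    exact: subset_trans (subsetDl _ _) F'F.
  rewrite !inE eqxx /= orbF (disjointFl dRF fF) /=.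
  by apply/negP => /(subsetP T'T); rewrite (disjointFr dFT fF).
have modular (F' T' : {set I}) : F' \subset F -> T' \subset T ->
    (c (R :|: F' :|: T') * c R = c (R :|: F') * c (R :|: T'))%N.
  move=> F'F T'T; have sub0T := sub0set T.
  have HT i : i \in T' -> sat (H R) (a i) by move=> /(subsetP T'T)/satT.
  have sS := subgroup_sat (sH R); have sQ := subgroup_addg (sH (R :|: F')) sS.
  (* The four subgroups are the spans of [R], [R :|: F'], [R :|: T'] and [R :|: F' :|: T']. *)
  apply: (homcnt_modular fgV finG divG (sH _) (sH _) (sH _) (sH _)
    _ _ _ _ _ _ _ _ (mcountP _) (mcountP _) (mcountP _) (mcountP _)).
  - by move=> x; apply: span_sublist_mono; apply: subsetUl.
  - by move=> x; apply: span_sublist_mono; rewrite setUAC subsetUl.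
  - by move=> x; apply: span_sublist_mono; apply: subsetUl.
  - apply: span_sublist_min => // i /setUP[iR|/HT //].
    by apply: sub_sat; apply: span_sublist_mem.
  - by move=> x; apply: span_sublist_mono; apply: subsetUl.
  - apply: span_sublist_min => // i /setUP[iRF|iT].
      by apply: addgl => //; apply: span_sublist_mem.
    by apply: addgr => //; apply: HT.
  - by move=> x; have := inj F' set0 x F'F sub0T; rewrite !setU0.
  - by move=> x; apply: inj.
have [mF [mFE mF0]] : exists m : {set I} -> nat,
    (forall J : {set I}, J \subset F -> homcnt G (hull a (H R) (F :\: J)) (m J)) /\
    0 <= \sum_(J : {set I} | J \subset F) (-1) ^+ #|J| * (m J)%:Z.
  apply: alternating_coloop_ge0 => // f fF; rewrite hull_sublist; apply: indF => //.
    by rewrite -!setUA; apply: setUS; exact: subset_trans (subsetDl _ _) (subsetUl _ _).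
  by rewrite !inE eqxx /= orbF (disjointFl dRF fF).
have [mT [mTE mT0]] := alternating_hull_ge0 fgV finG (sH R) satT.
have cR : 0 < (c R)%:Z by rewrite ltz_nat mcount_gt0.
rewrite -(pmulr_lge0 _ cR) [X in 0 <= X](_ : _ =
  (\sum_(J : {set I} | J \subset F) (-1) ^+ #|J| * (mF J)%:Z) *
  (\sum_(K : {set I} | K \subset T) (-1) ^+ #|K| * (mT K)%:Z)); first exact: mulr_ge0.
rewrite !mulr_suml; apply: eq_bigr => J JF; rewrite mulr_suml mulr_sumr.
apply: eq_bigr => K KT.
have -> : mF J = c (R :|: (F :\: J)).
  by apply: homcnt_uniq (mFE J JF) _; rewrite hull_sublist; apply: mcountP.
have -> : mT K = c (R :|: K).
  by apply: homcnt_uniq (mTE K KT) _; rewrite hull_sublist; apply: mcountP.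
have := modular _ _ (subsetDl F J) KT => /(congr1 Posz); rewrite !PoszM => e.
transitivity ((-1) ^+ #|J| * (-1) ^+ #|K| * ((c (R :|: (F :\: J) :|: K))%:Z * (c R)%:Z)).
  by ring.
by rewrite e; ring.
Qed.

Lemma tutteG_interval :
  tutteG G A = interval_poly (fun S => (c S)%:Z) r set0 setT.
Proof.
(* The sublist on all indices is compared with [A] through its span, on which the rank depends. *)
have rA : zrank A = r setT.
  apply/esym/zrank_uniq; rewrite (_ : in_span _ = in_span A); first exact: zrankP.
  apply/funext => x; apply/propext; split.
    apply: span_sublist_min; first exact: subgroup_span.
    by move=> i _; apply/mem_in_span/mem_nth.
  apply: span_min; first exact: subgroup_span.
  move=> y /(nthP 0)[i iA <-]; exact: (@span_sublist_mem setT (Ordinal iA)).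
rewrite /tutteG /interval_poly; apply: eq_big => [S|S _]; first by rewrite sub0set subsetT.
by rewrite rA.
Qed.

Lemma tutteG_nonneg : nonneg_coefs (tutteG G A).
Proof.
rewrite tutteG_interval; apply: interval_nonneg.
- move=> i S; rewrite zrank_add.
  by case: asboolP => _; [left; rewrite addn0|right; rewrite addn1].
- move=> i S T ST /zrank_loopE si; apply/zrank_loopE; apply: sat_mono si => x.
  exact: span_sublist_mono.
- exact: mcount_molecule.
- exact: sub0set.
- rewrite cards0; apply: zrank_uniq; rewrite /sublist enum_set0.
  exact: rank_is_nil.
Qed.

End Tutte.

Theorem mainTheorem18 (Gam G : zmodType) (A : seq Gam)
  (hGam : fingen Gam) (hfin : torsionwise_finite G) (hdiv : divisible G) :
  forall i j : nat, 0 <= ((tutteG G A)`_j)`_i.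
Proof.
by move=> i j; apply: tutteG_nonneg.
Qed.
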